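(* The Master Teapot $\Upsilon_2^{cp}$ contains the unit cylinder $S^1\times[1,2]$, where $S^1=\{z\in\mathbb{C}:|z|=1\}$.
   Context: A unimodal map is a continuous self-map of a compact real interval with exactly one turning point, called its critical point. It is critically periodic if the critical point is a fixed point of some forward iterate $f^n$, $n\ge 1$. $\mathcal{F}^{cp}$ denotes the family of critically periodic unimodal continuous self-maps of compact real intervals. The growth rate of $f$ is $\lambda(f)=e^{h_{top}(f)}$, where $h_{top}$ is topological entropy; for $f\in\mathcal{F}^{cp}$ it is an algebraic integer. The Galois conjugates of $\lambda$ are all the complex roots of its minimal polynomial over $\mathbb{Q}$. Thurston's Master Teapot is the closure $$\Upsilon_2^{cp}:=\overline{\{(z,\lambda)\in\mathbb{C}\times\mathbb{R} \mid \lambda=\lambda(f)\text{ for some } f\in\mathcal{F}^{cp},\ z\text{ is a Galois conjugate of }\lambda\}}.$$ *)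

(* Defs.v *)
(* MathComp-Analysis, over an arbitrary realType R; complex numbers are R[i]. *)
From mathcomp Require Import all_boot all_order all_algebra.
From mathcomp Require Import all_classical all_reals all_analysis.
From mathcomp.real_closed Require Export complex.

Set Implicit Arguments.
Unset Strict Implicit.
Unset Printing Implicit Defensive.

Import Order.TTheory GRing.Theory Num.Theory.
Import numFieldNormedType.Exports.

Local Open Scope classical_set_scope.
Local Open Scope ring_scope.

(* Topological entropy of a self-map of K `<=` R, after Bowen.  Maps are total
   functions R -> R; when f maps K to K, only the values of f on K matter. *)

Definition bowen_dist (R : realType) (f : R -> R) (n : nat) (x y : R) : R :=
  \big[Num.max/0]_(i < n) `|iter i f x - iter i f y|.

Definition bowen_separated (R : realType) (f : R -> R) (K : set R) (n : nat)
    (eps : R) (s : seq R) : Prop :=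
  [/\ uniq s, (forall x, x \in s -> K x) &
      forall x y, x \in s -> y \in s -> x != y -> eps < bowen_dist f n x y].

(* Largest cardinality of an (n, eps)-separated subset of K. *)
Definition separated_card (R : realType) (f : R -> R) (K : set R) (n : nat)
    (eps : R) : \bar R :=
  ereal_sup [set (size s)%:R%:E | s in [set s | bowen_separated f K n eps s]].

Definition entropy_at (R : realType) (f : R -> R) (K : set R) (eps : R) :
    \bar R :=
  limn_esup (fun n => (n%:R^-1)%:E * lne (separated_card f K n eps))%E.

(* entropy_at is nonincreasing in eps, so this supremum is the limit
   as eps tends to 0 from the right. *)
Definition topological_entropy (R : realType) (f : R -> R) (K : set R) :
    \bar R :=
  ereal_sup [set entropy_at f K eps | eps in [set eps : R | 0 < eps]].

Definition growth_rate (R : realType) (f : R -> R) (K : set R) : \bar R :=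
  expeR (topological_entropy f K).

(* Interior local extremum, in the weak sense.  A continuous f on [a, b] whose
   only turning point is c is therefore strictly monotone on [a, c] and on
   [c, b], in opposite directions; flat pieces are excluded. *)
Definition turning_point (R : realType) (f : R -> R) (a b c : R) : Prop :=
  a < c < b /\
  ((\forall x \near c, f x <= f c) \/ (\forall x \near c, f c <= f x)).

(* f is a unimodal self-map of [a, b] with critical point c. *)
Definition unimodal (R : realType) (f : R -> R) (a b c : R) : Prop :=
  [/\ {within `[a, b], continuous f},
      (forall x, x \in `[a, b] -> f x \in `[a, b]),
      turning_point f a b c &
      forall c', turning_point f a b c' -> c' = c].

Definition critically_periodic (R : realType) (f : R -> R) (a b : R) : Prop :=
  exists2 c : R, unimodal f a b c &
    exists2 n : nat, (0 < n)%N & iter n f c = c.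

Definition is_minimal_polynomial (R : realType) (p : {poly rat}) (x : R) :
    Prop :=
  [/\ p \is monic, root (map_poly ratr p) x &
      forall q : {poly rat}, q != 0 -> root (map_poly ratr q) x ->
        (size p <= size q)%N].

Definition galois_conjugate (R : realType) (z : R[i]) (x : R) : Prop :=
  exists2 p : {poly rat}, is_minimal_polynomial p x & root (map_poly ratr p) z.

(* R[i]^o carries the usual topology of the complex norm. *)
Definition teapot_points (R : realType) : set (R[i]^o * R) :=
  [set zl : R[i]^o * R | exists f : R -> R, exists a b : R,
     [/\ critically_periodic f a b,
         growth_rate f `[a, b] = zl.2%:E &
         galois_conjugate zl.1 zl.2]].

Definition master_teapot (R : realType) : set (R[i]^o * R) :=
  closure (@teapot_points R).

Definition unit_circle (R : realType) : set R[i]^o := [set z | `|z| = 1].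

(* Main.v *)
(** Idea.  On [[-1, 1]] the tent map [tent l x = 1 - l |x|] has growth rate [l].
    If [0] is periodic of period [n] for [tent l], then [l] is a root of a
    polynomial of degree [n - 1] with coefficients [+-1], read off the signs of
    the critical orbit.  For [n = 2 ^ k] this polynomial is [(X + 1) ^ (n - 1)]
    modulo 2, so it is irreducible (Eisenstein at [X = 1]) as soon as its value
    at 1 is not divisible by 4, i.e. as soon as the critical orbit is negative
    at an odd number of odd times.

    Every polynomial of large degree with coefficients of modulus 1 has a root
    near each point [z0] of the unit circle.  Otherwise, for [z1], [z2] close
    to [r z0] and [z0 / r], the product [|P z1| |P z2|] would be at most
    [|P w| ^ 2 (1 + O((1 - r) ^ 2)) ^ deg P], [w] being their midpoint, while
    the maximum principle provides such points with [|P z1|] bounded below and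
    [|P z2|] at least a constant times [r ^ - deg P].

    It remains to find, in every parameter interval, suitable [l] with [n = 2 ^ k]
    arbitrarily large.  When [sqrt 2 < l < 2] the critical orbit crosses the
    fixed point [tent_fix l] for some parameter of the interval; close to such
    a parameter the orbit can be made to follow the initial itinerary, then [q1]
    signs +, one sign - and [q2] signs +, and to hit [0], for any large [q1] and
    [q2]; the parity of [q1] decides the condition modulo 4.
    Parameters in [(1, sqrt 2]] are reached by taking square roots, because
    [tent l] renormalises to [tent (l ^ 2)]. *)
Require Import Defs.
From mathcomp Require Import all_boot all_order all_algebra.
From mathcomp Require Import all_classical all_reals all_analysis.
From mathcomp Require Import ring lra zify.
Import Order.TTheory GRing.Theory Num.Theory.
Import numFieldNormedType.Exports.
Local Open Scope classical_set_scope.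
Local Open Scope ring_scope.

Set Implicit Arguments.
Unset Strict Implicit.
Unset Printing Implicit Defensive.

(** * Roots of polynomials with unimodular coefficients *)

Section Modulus.
Local Open Scope complex_scope.
Variable R : rcfType.
Implicit Types z w : R[i].

Definition cabs z : R := complex.Re `|z|.

Lemma cabsE z : `|z| = (cabs z)%:C.
Proof. by []. Qed.

Lemma cabs_ge0 z : 0 <= cabs z.
Proof. by rewrite -lecR -cabsE normr_ge0. Qed.

Lemma cabsM z w : cabs (z * w) = cabs z * cabs w.
Proof. by apply: complexI; rewrite rmorphM -!cabsE normrM. Qed.

Lemma cabsD z w : cabs (z + w) <= cabs z + cabs w.
Proof. by rewrite -lecR rmorphD -!cabsE ler_normD. Qed.

Lemma cabsN z : cabs (- z) = cabs z.
Proof. by apply: complexI; rewrite -!cabsE normrN. Qed.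

Lemma cabsB z w : cabs (z - w) = cabs (w - z).
Proof. by rewrite -cabsN opprB. Qed.

Lemma cabsX z n : cabs (z ^+ n) = cabs z ^+ n.
Proof. by apply: complexI; rewrite rmorphXn -!cabsE normrX. Qed.

Lemma cabsV z : cabs z^-1 = (cabs z)^-1.
Proof. by apply: complexI; rewrite fmorphV -!cabsE normfV. Qed.

Lemma cabs1 : cabs 1 = 1.
Proof. by apply: complexI; rewrite -cabsE normr1. Qed.

Lemma cabs0 : cabs 0 = 0.
Proof. by apply: complexI; rewrite -cabsE normr0. Qed.

Lemma cabs_eq0 z : (cabs z == 0) = (z == 0).
Proof. by rewrite -(inj_eq (@complexI R)) -cabsE rmorph0 normr_eq0. Qed.

Lemma cabsR (x : R) : cabs x%:C = `|x|.
Proof. by rewrite /cabs normc_def /= expr0n addr0 sqrtr_sqr. Qed.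

Lemma cabs_nat (n : nat) : cabs n%:R = n%:R.
Proof. by rewrite -[n%:R in LHS](rmorph_nat (real_complex R)) cabsR ger0_norm ?ler0n. Qed.

Lemma cabs_triangle u z w : cabs (z - w) <= cabs (z - u) + cabs (u - w).
Proof. by apply: le_trans (cabsD _ _); rewrite addrA subrK. Qed.

Lemma cabs_prod (I : Type) (s : seq I) (F : I -> R[i]) :
  cabs (\prod_(i <- s) F i) = \prod_(i <- s) cabs (F i).
Proof. exact: (big_morph cabs cabsM cabs1). Qed.

Lemma cabs_sum (I : Type) (s : seq I) (P : pred I) (F : I -> R[i]) :
  cabs (\sum_(i <- s | P i) F i) <= \sum_(i <- s | P i) cabs (F i).
Proof.
elim/big_rec2 : _ => [|i x y _ le]; first by rewrite cabs0.
by apply: le_trans (cabsD _ _) _; rewrite lerD2l.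
Qed.

(* One of the two square roots of [v] does not make the even part of [Q]
   smaller, because it is the mean of the values of [Q] at these roots. *)
Lemma exists_unit_horner_ge (Q : {poly R[i]}) :
  exists2 v : R[i], cabs v = 1 & cabs Q.[0] <= cabs Q.[v].
Proof.
have [n] := ubnP (size Q); elim: n Q => // n IHn Q szQ.
have [szQ1|szQ1] := leqP (size Q) 1.
  by exists 1; rewrite ?cabs1 // (size1_polyC szQ1) !hornerC.
have szE : (size (even_poly Q) < n)%N.
  by apply: leq_ltn_trans (size_even_poly Q) _; rewrite uphalfE; lia.
have [v nv Ev] := IHn _ szE.
have QE0 : Q.[0] = (even_poly Q).[0].
  by rewrite !horner_coef0 coef_even_poly.
have ns : cabs (sqrtc v) = 1.
  by apply/eqP; rewrite -sqrp_eq1 ?cabs_ge0 // -cabsX sqr_sqrtc nv.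
have QE s : s ^+ 2 = v ->
    Q.[s] = (even_poly Q).[v] + (odd_poly Q).[v] * s.
  move=> sv; rewrite -[in LHS](poly_even_odd Q) hornerD hornerM !horner_comp.
  by rewrite hornerXn hornerX sv.
have Qp := QE _ (sqr_sqrtc v).
have Qm : Q.[- sqrtc v] = _ := QE _ (etrans (sqrrN _) (sqr_sqrtc v)).
have sum : cabs Q.[0] * 2 <= cabs Q.[sqrtc v] + cabs Q.[- sqrtc v].
  apply: le_trans (cabsD _ _); rewrite Qp Qm mulrN addrACA subrr addr0.
  have -> (x : R[i]) : x + x = x * 2 by ring.
  by rewrite cabsM cabs_nat QE0 ler_wpM2r.
have [le1|gt1] := lerP (cabs Q.[0]) (cabs Q.[sqrtc v]); first by exists (sqrtc v).
by exists (- sqrtc v); [rewrite cabsN | lra].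
Qed.

(** Square roots of a net form a finer net. The distances from [w] to the two square roots of [v]
    have product [|w ^ 2 - v|] and squares summing to 4, so the larger one is at least [sqrt 2] and
    the smaller at most [|w ^ 2 - v| / sqrt 2]; 3/4 is a rational bound for [1 / sqrt 2]. *)
Lemma unit_circle_net (k : nat) : exists U : seq R[i],
  [/\ size U = (2 ^ k)%N, {in U, forall u, cabs u = 1} &
   forall w, cabs w = 1 -> exists2 u, u \in U & cabs (w - u) <= 2 * (3 / 4) ^+ k].
Proof.
elim: k => [|k [U [szU nU dU]]].
  exists [:: 1]; split=> // [u|w nw]; first by rewrite inE => /eqP->; exact: cabs1.
  exists 1; rewrite ?mem_head // expr0 mulr1.
  by apply: le_trans (cabsD _ _) _; rewrite cabsN cabs1 nw.
have ns v : cabs v = 1 -> cabs (sqrtc v) = 1.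
  by move=> nv; apply/eqP; rewrite -sqrp_eq1 ?cabs_ge0 // -cabsX sqr_sqrtc nv.
exists ([seq sqrtc v | v <- U] ++ [seq - sqrtc v | v <- U]); split.
- by rewrite size_cat !size_map szU expnS mul2n addnn.
- by move=> u; rewrite mem_cat => /orP[] /mapP[v /nU/ns nv ->]; rewrite ?cabsN.
move=> w nw; have [|v vU dv] := dU (w ^+ 2); first by rewrite cabsX nw expr1n.
have := dv; rewrite -(sqr_sqrtc v) subr_sqr cabsM => dv'.
have par : cabs (w - sqrtc v) ^+ 2 + cabs (w + sqrtc v) ^+ 2 = 4.
  apply: complexI; rewrite rmorphD !rmorphXn /= -!cabsE !sqr_normc.
  have nE z : cabs z = 1 -> z * z^* = 1 by move=> nz; rewrite -sqr_normc cabsE nz expr1n.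
  have nwE := nE _ nw; have nsE := nE _ (ns _ (nU _ vU)).
  rewrite [RHS](rmorph_nat (real_complex R) 4) !rmorphB !rmorphD /=.
  transitivity (2 * (w * w^* + sqrtc v * (sqrtc v)^*)); first by ring.
  by rewrite nwE nsE; ring.
set x := cabs (w - _) in dv' par; set y := cabs (w + _) in dv' par.
have x0 : 0 <= x := cabs_ge0 _; have y0 : 0 <= y := cabs_ge0 _.
have e0 : 0 <= (3 / 4 : R) ^+ k by rewrite exprn_ge0 // divr_ge0.
rewrite exprS; set e := _ ^+ k in dv' e0 *.
have [lexy|ltyx] := lerP x y.
  exists (sqrtc v); first by rewrite mem_cat map_f.
  by rewrite -/x; nra.
exists (- sqrtc v); first by rewrite mem_cat; apply/orP; right; apply/mapP; exists v.
by rewrite opprK -/y; nra.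
Qed.


Lemma cabs_horner_le (P : {poly R[i]}) (z : R[i]) (t : R) :
  (forall i, cabs P`_i <= 1) -> cabs z <= t ->
  cabs P.[z] <= \sum_(i < size P) t ^+ i.
Proof.
move=> P1 zt; rewrite horner_coef; apply: le_trans (cabs_sum _ _ _) _.
apply: ler_sum => i _; rewrite cabsM cabsX -[leRHS]mul1r.
have t0 : 0 <= t := le_trans (cabs_ge0 _) zt.
by apply: ler_pM; rewrite ?exprn_ge0 ?cabs_ge0 // lerXn2r ?nnegrE ?cabs_ge0.
Qed.

Lemma cabs_horner_disk (P : {poly R[i]}) (z : R[i]) (r : R) :
  r < 1 -> (forall i, cabs P`_i <= 1) -> cabs z <= r ->
  cabs P.[z] <= (1 - r)^-1.
Proof.
move=> r1 P1 zr; apply: le_trans (cabs_horner_le P1 zr) _.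
have r0 : 0 <= r := le_trans (cabs_ge0 _) zr.
rewrite -[leRHS]mul1r ler_pdivlMr ?subr_gt0 // mulrC.
by rewrite -[1 - r]opprB mulNr -subrX1 opprB gerBl exprn_ge0.
Qed.

Lemma cabs_horner_big (P : {poly R[i]}) (z : R[i]) (t : R) :
  1 <= t -> (forall i, cabs P`_i <= 1) -> cabs z <= t ->
  cabs P.[z] <= (size P)%:R * t ^+ (size P).-1.
Proof.
move=> t1 P1 zt; apply: le_trans (cabs_horner_le P1 zt) _.
apply: (@le_trans _ _ (\sum_(i < size P) t ^+ (size P).-1)).
  by apply: ler_sum => i _; rewrite ler_weXn2l //; have := ltn_ord i; lia.
by rewrite sumr_const card_ord mulr_natl.
Qed.

(* Rotating [P] over a net and multiplying, the maximum principle gives a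
   point where the product is at least 1; then each single factor is bounded
   below, in particular the one whose argument is near [r * z0]. *)
Lemma large_value_inside (P : {poly R[i]}) (z0 : R[i]) (r : R) (k : nat) :
  cabs P`_0 = 1 -> (forall i, cabs P`_i <= 1) -> cabs z0 = 1 -> 0 < r < 1 ->
  exists z, [/\ cabs z = r, cabs (z - r%:C * z0) <= r * (2 * (3 / 4) ^+ k) &
                (1 - r) ^+ (2 ^ k) <= cabs P.[z]].
Proof.
move=> P01 P1 nz0 /andP[r0 r1].
have [U [szU nU dU]] := unit_circle_net k.
pose Q := \prod_(u <- U) (P \Po ((r%:C * u) *: 'X)).
have QE v : cabs Q.[v] = \prod_(u <- U) cabs P.[r%:C * u * v].
  rewrite horner_prod cabs_prod; apply: eq_bigr => u _.
  by rewrite horner_comp hornerZ hornerX.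
have [v nv] := exists_unit_horner_ge Q; rewrite QE big1 => [|u _]; last first.
  by rewrite mulr0 horner_coef0.
rewrite QE => le1.
have v0 : v != 0 by rewrite -cabs_eq0 nv oner_neq0.
have [|u uU du] := dU (z0 / v); first by rewrite cabsM cabsV nz0 nv divr1.
exists (r%:C * u * v); have nu := nU _ uU.
have cr : cabs r%:C = r by rewrite cabsR gtr0_norm.
split; first by rewrite !cabsM cr nu nv !mulr1.
  rewrite (_ : _ - _ = r%:C * - (z0 / v - u) * v); last by field.
  by rewrite !cabsM cabsN cr nv mulr1 ler_wpM2l // ltW.
have q0 : 0 < 1 - r by rewrite subr_gt0.
rewrite (big_rem u uU) /= in le1.
(* Each of the [2 ^ k - 1] other factors is at most the geometric series of ratio [r]. *)
have le2 : \prod_(y <- rem u U) cabs P.[r%:C * y * v] <= (1 - r)^-1 ^+ (2 ^ k).-1.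
  have -> : (2 ^ k).-1 = size (rem u U) by rewrite size_rem // szU.
  have sub : {subset rem u U <= U} by exact: mem_rem.
  elim: (rem u U) sub => [|y s IHs] sub; first by rewrite big_nil expr0.
  rewrite big_cons exprS; apply: ler_pM; rewrite ?cabs_ge0 //.
  - by apply: prodr_ge0 => *; exact: cabs_ge0.
  - apply: cabs_horner_disk => //.
    by rewrite !cabsM cr nv nU ?mulr1 // sub ?mem_head.
  - by apply: IHs => x xs; apply: sub; rewrite inE xs orbT.
have le3 := le_trans le1 (ler_wpM2l (cabs_ge0 _) le2).
have eN : (1 - r) ^+ (2 ^ k).-1 <= cabs P.[r%:C * u * v].
  by move: le3; rewrite exprVn ler_pdivlMr ?exprn_gt0 // mul1r.
apply: le_trans eN; rewrite ler_wiXn2l ?leq_pred //; first exact: ltW.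
by rewrite gerBl ltW.
Qed.

Lemma horner_rev_poly (P : {poly R[i]}) (d : nat) (z : R[i]) :
  (size P <= d.+1)%N -> z != 0 ->
  (\poly_(i < d.+1) P`_(d - i)).[z] = z ^+ d * P.[z^-1].
Proof.
move=> szP z0; rewrite horner_poly (horner_coef_wide _ szP) mulr_sumr.
rewrite (reindex_inj rev_ord_inj) /=; apply: eq_bigr => i _.
have id : (i <= d)%N by rewrite -ltnS.
rewrite subSS subKn // exprVn mulrCA -exprB ?unitfE //.
Qed.

(** The reciprocal polynomial again has unimodular coefficients. Its large value near [r / z0]
    turns, under inversion, into one of [P] near [z0 / r]; the power of [r] comes from the
    reversal. *)
Lemma large_value_outside (P : {poly R[i]}) (z0 : R[i]) (r : R) (k : nat) :
  (forall i, (i < size P)%N -> cabs P`_i = 1) -> P != 0 ->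
  cabs z0 = 1 -> 0 < r < 1 ->
  exists z, [/\ cabs z = r^-1,
                cabs (z - (r%:C)^-1 * z0) <= r^-1 * (2 * (3 / 4) ^+ k) &
                (1 - r) ^+ (2 ^ k) <= r ^+ (size P).-1 * cabs P.[z]].
Proof.
move=> P1 Pn0 nz0 r01; have [r0 r1] := andP r01.
have szP : size P = (size P).-1.+1 by rewrite prednK // size_poly_gt0.
set d := (size P).-1 in szP *.
have [|i||z [nz dz vz]] := @large_value_inside (\poly_(i < d.+1) P`_(d - i)) z0^-1 r k _ _ _ r01.
- by rewrite coef_poly /= subn0 P1 // szP.
- rewrite coef_poly; case: ifP => _; last by rewrite cabs0.
  have [ltd|led] := ltnP (d - i) (size P); first by rewrite P1.
  by rewrite nth_default ?cabs0.
- by rewrite cabsV nz0 invr1.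
have z_n0 : z != 0 by rewrite -cabs_eq0 nz gt_eqF.
have z0_n0 : z0 != 0 by rewrite -cabs_eq0 nz0 oner_neq0.
have cr : cabs r%:C = r by rewrite cabsR gtr0_norm.
have rC0 : r%:C != 0 :> R[i] by rewrite -cabs_eq0 cr gt_eqF.
exists z^-1; split; first by rewrite cabsV nz.
  rewrite (_ : _ - _ = - (z - r%:C * z0^-1) * z0 / (r%:C * z)); last first.
    by field; rewrite z_n0 z0_n0 rC0.
  rewrite !cabsM cabsN cabsV cabsM cr nz nz0 mulr1.
  rewrite ler_pdivrMr ?mulr_gt0 //; apply: le_trans dz _.
  by rewrite mulrACA mulVf ?gt_eqF // mul1r mulrC.
by rewrite horner_rev_poly ?szP // cabsM cabsX nz in vz.
Qed.

(** For each root [a], [(w + u - a) (w - u - a) = (w - a) ^ 2 - u ^ 2], which is at most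
    [|w - a| ^ 2 (1 + (|u| / e) ^ 2)] in modulus; these bounds are multiplied over all roots. *)
Lemma horner_far_roots (P : {poly R[i]}) (w u : R[i]) (e : R) :
  0 < e -> (forall a, root P a -> e <= cabs (w - a)) ->
  cabs P.[w + u] * cabs P.[w - u] <=
    cabs P.[w] ^+ 2 * (1 + (cabs u / e) ^+ 2) ^+ (size P).-1.
Proof.
move=> e0 far; have [->|Pn0] := eqVneq P 0.
  by rewrite !horner0 cabs0 mul0r expr0n mul0r.
have [s defP] := closed_field_poly_normal P.
have szP : size s = (size P).-1.
  by rewrite defP size_scale ?lead_coef_eq0 // size_prod_XsubC.
have rs a : a \in s -> e <= cabs (w - a).
  move=> as_; apply: far; rewrite defP rootE hornerZ.
  by have := root_prod_XsubC s a; rewrite as_ rootE => /eqP->; rewrite mulr0.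
have hE x : cabs P.[x] = cabs (lead_coef P) * \prod_(a <- s) cabs (x - a).
  rewrite {1}defP hornerZ cabsM horner_prod cabs_prod.
  by congr (_ * _); apply: eq_bigr => a _; rewrite hornerXsubC.
rewrite -szP !hE mulrACA -expr2 exprMn -[leRHS]mulrA ler_wpM2l ?sqr_ge0 //.
elim: s rs {defP szP hE} => [|a s IHs] rs; first by rewrite !big_nil expr1n !mul1r.
rewrite !big_cons mulrACA exprMn [size _]/= (exprS _ (size s)) [leRHS]mulrACA.
apply: ler_pM.
- by rewrite mulr_ge0 ?cabs_ge0.
- by rewrite mulr_ge0 ?prodr_ge0 // => *; exact: cabs_ge0.
- rewrite -cabsM (_ : _ * _ = (w - a) ^+ 2 - u ^+ 2); last by ring.
  apply: le_trans (cabsD _ _) _; rewrite cabsN !cabsX mulrDr mulr1 lerD2l.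
  have ea := rs a (mem_head _ _).
  rewrite expr_div_n mulrA ler_pdivlMr ?exprn_gt0 // mulrC ler_wpM2r ?sqr_ge0 //.
  by rewrite lerXn2r ?nnegrE ?cabs_ge0 // ltW.
- by apply: IHs => x xs; apply: rs; rewrite inE xs orbT.
Qed.

End Modulus.

(** * Growth estimates, and a root near each point of the unit circle *)

Section Real.
Local Open Scope complex_scope.
Variable R : realType.

Lemma bernoulli_ge (h : R) (n : nat) : 0 <= h -> 1 + n%:R * h <= (1 + h) ^+ n.
Proof.
move=> h0; elim: n => [|n IHn]; first by rewrite mul0r addr0 expr0.
rewrite exprS -natr1; have n0 : 0 <= n%:R :> R by rewrite ler0n.
nra.
Qed.

Lemma exists_nat_ge (x : R) : exists N : nat, forall n, (N <= n)%N -> x <= n%:R.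
Proof.
exists (Num.bound `|x|) => n; rewrite -(ler_nat R); apply: le_trans.
exact: le_trans (ler_norm x) (ltW (archi_boundP (normr_ge0 x))).
Qed.

Lemma exists_expr_ge (a x : R) : 1 < a ->
  exists N : nat, forall n, (N <= n)%N -> x <= a ^+ n.
Proof.
move=> a1; have [N hN] := exists_nat_ge (x / (a - 1)).
exists N => n /hN; rewrite ler_pdivrMr ?subr_gt0 // => le.
have a0 : 0 <= a - 1 by lra.
by have := bernoulli_ge n a0; rewrite [1 + (a - 1)]addrC subrK; lra.
Qed.

Lemma exists_expr_le (q e : R) : 0 < q < 1 -> 0 < e ->
  exists N : nat, forall n, (N <= n)%N -> q ^+ n <= e.
Proof.
move=> /andP[q0 q1] e0; have [|N hN] := @exists_expr_ge q^-1 e^-1.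
  by rewrite invf_gt1.
by exists N => n /hN; rewrite exprVn lef_pV2 // posrE // exprn_gt0.
Qed.

(** Since [q (1 + h) ^ 3 <= 1], the cube of Bernoulli's inequality bounds [(d + 1) ^ 3 q ^ d] by
    [h ^ -3]; one factor [d + 1] is left to make the square version small. *)
Lemma sqr_mul_expr_small (q c : R) : 0 < q < 1 -> 0 < c ->
  exists N : nat, forall d, (N <= d)%N -> d.+1%:R ^+ 2 * q ^+ d < c.
Proof.
move=> /andP[q0 q1] c0; pose h := (1 - q) / 7.
have h0 : 0 < h by rewrite /h; lra.
have qE : q = 1 - 7 * h by rewrite /h; field.
have qh : q * (1 + h) ^+ 3 <= 1.
  rewrite qE [leLHS](_ : _ = 1 - (4 * h + 18 * h ^+ 2 + 20 * h ^+ 3 + 7 * h ^+ 4)).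
    by rewrite gerBl !addr_ge0 // mulr_ge0 // ?exprn_ge0 // ltW.
  by ring.
have [N hN] := exists_nat_ge (h ^- 3 / c).
exists N => d /hN le.
have B : h * d.+1%:R <= (1 + h) ^+ d.
  by apply: le_trans (bernoulli_ge d (ltW h0)); rewrite -natr1 /h; nra.
have B3 : (h * d.+1%:R) ^+ 3 <= (1 + h) ^+ 3 ^+ d.
  by rewrite exprAC lerXn2r // nnegrE; [apply: mulr_ge0; rewrite ?ler0n ?ltW | rewrite exprn_ge0 //; lra].
have q1d : q ^+ d * (1 + h) ^+ 3 ^+ d <= 1.
  by rewrite -exprMn exprn_ile1 // mulr_ge0 ?exprn_ge0 //; lra.
set A := _ ^+ d in B3 q1d; set D := _%:R in B B3 le *.
have D0 : 0 < D by rewrite /D ltr0n.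
have le' : 1 < c * h ^+ 3 * D.
  move: le; rewrite ler_pdivrMr // -[h ^- 3]mul1r ler_pdivrMr ?exprn_gt0 //.
  rewrite /D -natr1; have : 0 < h ^+ 3 by rewrite exprn_gt0.
  by move: (h ^+ 3) => h3 h30; nra.
set Q := q ^+ d in q1d *; have Q0 : 0 < Q by rewrite exprn_gt0.
have h30 : 0 < h ^+ 3 by rewrite exprn_gt0.
have s1 : Q * (h ^+ 3 * D ^+ 3) <= 1.
  by apply: le_trans q1d; rewrite ler_wpM2l ?(ltW Q0) // -exprMn.
have s2 : (D ^+ 2 * Q) * (h ^+ 3 * D) < c * (h ^+ 3 * D).
  apply: (@le_lt_trans _ _ 1); last by rewrite mulrA.
  by rewrite [leLHS](_ : _ = Q * (h ^+ 3 * D ^+ 3)) //; ring.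
by rewrite -(ltr_pM2r (mulr_gt0 h30 D0)).
Qed.

Lemma root_near_unit_circle (z0 : R[i]) (eps : R) : cabs z0 = 1 -> 0 < eps ->
  exists N : nat, forall P : {poly R[i]}, (N < size P)%N ->
    (forall i, (i < size P)%N -> cabs P`_i = 1) ->
    exists2 a, root P a & cabs (a - z0) < eps.
Proof.
move=> nz0; wlog eps1 : eps / eps <= 1.
  move=> wl eps0; have [|/ltW le] := lerP eps 1; first by move/wl; apply.
  have [|N hN] := wl 1 (lexx _); first exact: ltr01.
  by exists N => P szP P1; have [a ra da] := hN _ szP P1; exists a; rewrite // (lt_le_trans da).
(* The half-difference [u] of the two points will be at most [3 * rho], so roots at distance at
   least [eps / 2] cost a factor at most [1 + (3 * rho / (eps / 2)) ^ 2 = 1 + 36 / 100 * rho] each,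
   too little to offset the gain [r = 1 - rho] per degree. *)
move=> eps0; pose rho := eps ^+ 2 / 100; pose r := 1 - rho.
have rho0 : 0 < rho by rewrite /rho divr_gt0 // exprn_gt0.
have rhoe : rho * 100 = eps ^+ 2 by rewrite /rho divfK // pnatr_eq0.
have rho1 : rho <= 1 / 100.
  have : eps ^+ 2 <= 1 by rewrite exprn_ile1 // ltW.
  by lra.
have r01 : 0 < r < 1 by rewrite /r; lra.
have [r0 r1] := andP r01.
have ri1 : r^-1 <= 1 + rho + 2 * rho ^+ 2.
  by rewrite -[leLHS]mul1r ler_pdivrMr // /r; nra.
have ri2 : 1 <= r^-1 by rewrite invf_ge1 // ltW.
(* The fineness of the net depends on [eps] only, so the lower bound [c] below serves all [P] at
   once. *)
have [k hk] : exists k : nat, 2 * (3 / 4 : R) ^+ k <= rho.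
  have [||k /(_ _ (leqnn k)) hk] := @exists_expr_le (3 / 4) (rho / 2); first lra.
    by lra.
  by exists k; lra.
set delta := 2 * _ in hk.
have delta0 : 0 <= delta by rewrite mulr_ge0 // exprn_ge0 //; lra.
(* [t] bounds the modulus of the midpoint and exceeds 1 by at most [rho ^ 2]; [B] is the resulting
   bound, per degree, for [|P z1| |P z2|]. *)
pose t := (r + r^-1) / 2; pose B := t ^+ 2 * (1 + 36 / 100 * rho).
have t1 : 1 <= t <= 1 + rho ^+ 2.
  have rri : r * r^-1 = 1 by rewrite divff // gt_eqF.
  rewrite /t; move: (r^-1) rri ri1 ri2 => ri; rewrite /r => rri ri1 ri2.
  have : rho <= rho * ri by rewrite ler_peMr // ltW.
  lra.
have rB : 0 < r * B < 1.
  have [ta tb] := andP t1.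
  have B1 : B <= (1 + rho ^+ 2) ^+ 2 * (1 + 36 / 100 * rho).
    by rewrite /B ler_wpM2r ?lerXn2r ?nnegrE //; nra.
  have B2 : 0 < B by rewrite /B mulr_gt0 ?exprn_gt0 //; nra.
  rewrite mulr_gt0 //=; apply: le_lt_trans (_ : r * ((1 + rho ^+ 2) ^+ 2 * (1 + 36 / 100 * rho)) < 1).
    by rewrite ler_wpM2l // ltW.
  have rho2 : rho ^+ 2 <= rho / 100 by rewrite expr2; nra.
  have b1 : (1 + rho ^+ 2) ^+ 2 <= 1 + 3 / 100 * rho.
    by move: (rho ^+ 2) rho2 (sqr_ge0 rho) => s; nra.
  have b2 : (1 + rho ^+ 2) ^+ 2 * (1 + 36 / 100 * rho) <= 1 + 50 / 100 * rho by nra.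
  by rewrite /r; nra.
pose c := (1 - r) ^+ (2 ^ k).
have c0 : 0 < c by rewrite exprn_gt0 // /r; lra.
have [N hN] := sqr_mul_expr_small rB (exprn_gt0 2 c0).
exists N => P szP P1; apply: contrapT => /forall2NP far.
have szP0 : (0 < size P)%N := leq_ltn_trans (leq0n N) szP.
have Pn0 : P != 0 by rewrite -size_poly_gt0.
have P1' i : cabs P`_i <= 1.
  by have [/P1->//|?] := ltnP i (size P); rewrite nth_default // cabs0.
have [|z1 [nz1 dz1 vz1]] := @large_value_inside _ P z0 r k _ P1' nz0 r01.
  by rewrite P1.
have [z2 [nz2 dz2 vz2]] := large_value_outside k P1 Pn0 nz0 r01.
set d := (size P).-1 in vz2; have szPd : size P = d.+1 by rewrite /d prednK.
have d1 : cabs (z1 - z0) <= 2 * rho.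
  apply: le_trans (cabs_triangle (r%:C * z0) _ _) _.
  have -> : cabs (r%:C * z0 - z0) = rho.
    rewrite (_ : _ - _ = (r - 1)%:C * z0); last by rewrite [in RHS]rmorphB /= mulrBl mul1r.
    by rewrite cabsM nz0 mulr1 cabsR /r distrC; rewrite (_ : 1 - _ = rho) ?gtr0_norm //; ring.
  by rewrite -/delta in dz1; nra.
have d2 : cabs (z2 - z0) <= 3 * rho.
  apply: le_trans (cabs_triangle ((r%:C)^-1 * z0) _ _) _.
  have -> : cabs ((r%:C)^-1 * z0 - z0) = r^-1 - 1.
    rewrite (_ : _ - _ = (r^-1 - 1)%:C * z0); last by rewrite [in RHS]rmorphB fmorphV /= mulrBl mul1r.
    by rewrite cabsM nz0 mulr1 cabsR ger0_norm // subr_ge0.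
  by rewrite -/delta in dz2; nra.
have two0 : 2 != 0 :> R[i] by rewrite pnatr_eq0.
have half (x y : R[i]) : cabs ((x + y) / 2) <= (cabs x + cabs y) / 2.
  by rewrite cabsM cabsV cabs_nat; apply: ler_wpM2r; rewrite ?invr_ge0 ?ler0n ?cabsD.
pose w := (z1 + z2) / 2; pose u := (z2 - z1) / 2.
have wu1 : w + u = z2 by rewrite /w /u; field.
have wu2 : w - u = z1 by rewrite /w /u; field.
have nw : cabs w <= t by apply: le_trans (half _ _) _; rewrite nz1 nz2.
have nu : cabs u <= 3 * rho.
  rewrite /u (_ : z2 - z1 = (z2 - z0) + (z0 - z1)); last by ring.
  by apply: le_trans (half _ _) _; rewrite (cabsB z0 z1); lra.
have dw : cabs (w - z0) <= 3 * rho.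
  rewrite /w (_ : _ - _ = ((z1 - z0) + (z2 - z0)) / 2); last by field.
  by apply: le_trans (half _ _) _; lra.
have e20 : 0 < eps / 2 by lra.
have farw a : root P a -> eps / 2 <= cabs (w - a).
  move=> ra; have [//|/negP] := far a; rewrite -leNgt => ea.
  have := cabs_triangle w a z0; rewrite (cabsB a w) => tr.
  by nra.
have := horner_far_roots u e20 farw; rewrite wu1 wu2 -/d.
have [ta tb] := andP t1.
have wB := cabs_horner_big ta P1' nw; rewrite szPd /= in wB.
have uB : 1 + (cabs u / (eps / 2)) ^+ 2 <= 1 + 36 / 100 * rho.
  have un := cabs_ge0 u.
  rewrite lerD2l expr_div_n ler_pdivrMr ?exprn_gt0 //.
  have : cabs u ^+ 2 <= (3 * rho) ^+ 2 by rewrite lerXn2r ?nnegrE //; lra.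
  rewrite [(eps / 2) ^+ 2]expr_div_n -rhoe; nra.
move=> main.
have main2 : cabs P.[z2] * cabs P.[z1] <= (d.+1%:R * t ^+ d) ^+ 2 * (1 + 36 / 100 * rho) ^+ d.
  apply: le_trans main _; apply: ler_pM.
  - exact: sqr_ge0.
  - by rewrite exprn_ge0 // addr_ge0 ?sqr_ge0.
  - by rewrite lerXn2r ?nnegrE ?cabs_ge0 // (le_trans _ wB) ?cabs_ge0.
  - rewrite lerXn2r ?nnegrE ?addr_ge0 ?sqr_ge0 //; nra.
have dN : (N <= d)%N by rewrite -ltnS -szPd.
have := hN _ dN; rewrite ltNge => /negP; apply.
rewrite expr2; apply: (@le_trans _ _ (r ^+ d * cabs P.[z2] * cabs P.[z1])).
  by apply: ler_pM => //; rewrite ltW.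
rewrite -mulrA; apply: le_trans (ler_wpM2l (exprn_ge0 _ (ltW r0)) main2) _.
rewrite /B [(r * _) ^+ d]exprMn [(_ * _) ^+ d in leRHS]exprMn (exprAC t 2 d).
by rewrite le_eqVlt; apply/orP; left; apply/eqP; ring.
Qed.

End Real.

(** * Kneading polynomials and irreducibility *)

(** The critical orbit satisfies [X (m + 1) = 1 - l |X m|]. If [e] marks its negative points, then
    [|X m| = (-1) ^ e m X m] and the recurrence becomes polynomial in [l]. *)
Fixpoint kneading_poly (e : nat -> bool) (n : nat) : {poly int} :=
  if n is m.+1 then 1 - (-1) ^+ e m *: ('X * kneading_poly e m) else 0.

Lemma kneading_poly_coef e n i :
  `|(kneading_poly e n)`_i| = (i < n)%:R.
Proof.
elim: n i => [|n IHn] i; first by rewrite coef0 normr0.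
rewrite /= coefB coef1 coefZ coefXM; case: i => [|i] /=.
  by rewrite mulr0 subr0 normr1.
by rewrite sub0r normrN normrM normr_sign mul1r IHn.
Qed.

Lemma size_kneading_poly e n : size (kneading_poly e n) = n.
Proof.
apply/eqP; rewrite eqn_leq; apply/andP; split.
  apply/leq_sizeP => i le; apply/eqP; rewrite -normr_eq0 kneading_poly_coef.
  by rewrite ltnNge le.
case: n => // n; apply: contraT; rewrite -ltnNge ltnS => /leq_sizeP/(_ n (leqnn _)).
by move=> /(congr1 Num.norm); rewrite kneading_poly_coef leqnn normr0.
Qed.

Lemma addpp_F2 (p : {poly 'F_2}) : p + p = 0.
Proof.
rewrite -[p]mulr1 -mulrDr -polyC1 -polyCD (_ : 1 + 1 = 0 :> 'F_2) ?mulr0 //.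
exact/val_inj.
Qed.

(** These are Eisenstein's conditions at the prime 2 for [P (X + 1)], whose constant term is [P 1].
    Stated before the translation, they pass easily to [P (X ^ 2)]. *)
Definition eisenstein_at1 (P : {poly int}) : Prop :=
  [/\ P \is monic, map_poly (intr : int -> 'F_2) P = ('X + 1) ^+ (size P).-1 &
      ~~ (4 %| P.[1])%Z].

(** Modulo 2, [X ^ 2 + 1] is [(X + 1) ^ 2], and squaring fixes the point 1. This carries
    irreducibility through renormalisation. *)
Lemma eisenstein_at1_sqr P : eisenstein_at1 P -> eisenstein_at1 (P \Po 'X^2).
Proof.
case=> mP P2 P4; split.
- have : lead_coef (P \Po 'X^2) = 1.
    rewrite lead_coef_comp ?size_polyXn // (monicP mP) lead_coefXn expr1n mulr1 //.
  by move/eqP.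
- rewrite map_comp_poly map_polyXn P2 size_comp_poly size_polyXn /= muln2.
  rewrite rmorphXn /= rmorphD rmorph1 /= comp_polyX.
  have -> : ('X^2 + 1 : {poly 'F_2}) = ('X + 1) ^+ 2.
    by rewrite sqrrD1 mulr2n addpp_F2 addr0.
  by rewrite -exprM mul2n.
- by rewrite horner_comp hornerXn expr1n.
Qed.

Lemma eisenstein_at1_minimal (R : realType) (P : {poly int}) (x : R) :
  eisenstein_at1 P -> root (map_poly intr P) x ->
  is_minimal_polynomial (map_poly intr P) x.
Proof.
case=> mP P2 P4 rx.
have Pn0 : P != 0 by exact: monic_neq0.
have szP : (1 < size P)%N.
  rewrite ltnNge; apply/negP => szP; move: rx mP.
  rewrite (size1_polyC szP) map_polyC rootC intr_eq0 => /eqP ->.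
  by rewrite polyC0 monicE lead_coef0.
have ratr_int_poly q : map_poly ratr (map_poly intr q) = map_poly intr q :> {poly R}.
  by rewrite -map_poly_comp; apply: eq_map_poly => a /=; rewrite ratr_int.
pose Q := P \Po ('X + 1).
have szX1 : size ('X + 1 : {poly int}) = 2 by rewrite -['X + 1]/('X + 1%:P) size_XaddC.
have szQ : size Q = size P by rewrite size_comp_poly2 // szX1.
have irrQ : irreducible_poly (map_poly (intr : int -> rat) Q).
  apply/irreducible_rat_int; apply: (@eisenstein_crit 2) => //.
  - by rewrite szQ; lia.
  - rewrite lead_coef_comp ?szX1 // (monicP mP) mul1r.
    by rewrite -['X + 1]/('X + 1%:P) lead_coefXaddC expr1n.
  - by rewrite -horner_coef0 horner_comp hornerD hornerX hornerC add0r.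
  - move=> i; rewrite szQ => lti.
    rewrite (dvdz_pcharf (pchar_Fp _)) // -coef_map map_comp_poly P2.
    rewrite rmorphD /= map_polyX rmorph1 rmorphXn /= rmorphD /= rmorph1 comp_polyX.
    have -> : ('X + 1 + 1 : {poly 'F_2}) = 'X.
      by rewrite -addrA addpp_F2 addr0.
    by rewrite coefXn ltn_eqF.
split.
- exact: monic_map.
- by rewrite ratr_int_poly.
move=> q qn0 rq.
pose sh := 'X + 1 : {poly rat}.
have shE : map_poly (intr : int -> rat) ('X + 1) = sh by rewrite rmorphD /= map_polyX rmorph1.
have szsh : size sh = 2 by rewrite /sh -['X + 1]/('X + 1%:P) size_XaddC.
have rootsh (p : {poly rat}) : root (map_poly ratr p) x -> root (map_poly ratr (p \Po sh)) (x - 1).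
  move=> rp; rewrite map_comp_poly rootE horner_comp /sh rmorphD /= map_polyX rmorph1.
  by rewrite hornerD hornerX hornerC subrK.
rewrite -(size_comp_poly2 q szsh); set p := map_poly _ P; rewrite -(size_comp_poly2 p szsh).
have QE : p \Po sh = map_poly intr Q by rewrite map_comp_poly shE.
have rp : root (map_poly ratr p) x by rewrite ratr_int_poly.
(* The gcd vanishes at [x - 1], so it is not constant; by irreducibility it is associate to the
   translate of [p], which therefore divides that of [q]. *)
set g := gcdp (p \Po sh) (q \Po sh).
have rg : root (map_poly ratr g) (x - 1) by rewrite gcdp_map root_gcd !rootsh.
have qn0' : q \Po sh != 0 by rewrite -size_poly_eq0 size_comp_poly2 // size_poly_eq0.
have gn0 : g != 0 by rewrite gcdp_eq0 (negPf qn0') andbF.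
have szg : size g != 1.
  apply/negP => /eqP szg; move: rg gn0; rewrite (size1_polyC (_ : size g <= 1)%N) ?szg //.
  by rewrite map_polyC rootC fmorph_eq0 polyC_eq0 => ->.
case: irrQ => _ /(_ g szg); rewrite -QE dvdp_gcdl => /(_ isT) geq.
apply: dvdp_leq => //; rewrite -(eqp_dvdl _ geq); exact: dvdp_gcdr.
Qed.

(** Signs disappear modulo 2, leaving [1 + X + ... + X ^ (n - 1)]. Its product with [X + 1] is
    [X ^ n + 1], which is [(X + 1) ^ n] by Frobenius when [n] is a power of 2. *)
Lemma kneading_poly_mod2 e k :
  map_poly (intr : int -> 'F_2) (kneading_poly e (2 ^ k)) = ('X + 1) ^+ (2 ^ k).-1.
Proof.
have opp (p : {poly 'F_2}) : - p = p by apply/esym/eqP; rewrite -addr_eq0 addpp_F2.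
have rec n : ('X + 1) * map_poly intr (kneading_poly e n) = 'X^n + 1 :> {poly 'F_2}.
  elim: n => [|n IHn]; first by rewrite /= map_poly0 mulr0 expr0 addpp_F2.
  rewrite /= rmorphB rmorph1 /= map_polyZ /= rmorphM /= map_polyX.
  have -> : ((-1) ^+ e n : int)%:~R = 1 :> 'F_2 by case: (e n); apply/val_inj.
  rewrite scale1r opp mulrDr mulr1 mulrCA IHn mulrDr mulr1 -exprS.
  rewrite (_ : 'X + 1 + _ = 'X^(n.+1) + 1 + ('X + 'X)); last by ring.
  by rewrite addpp_F2 addr0.
have n0 : ('X + 1 : {poly 'F_2}) != 0 by rewrite -['X + 1]/('X + 1%:P) -size_poly_eq0 size_XaddC.
apply: (mulfI n0); rewrite rec -exprS prednK ?expn_gt0 //.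
rewrite exprDn_pchar ?expr1n //.
have ch2 : 2 \in [pchar {poly 'F_2}] by rewrite pchar_poly pchar_Fp.
by rewrite (eq_pnat _ (pcharf_eq ch2)) pnatX pnat_id.
Qed.

(** Two steps of the recurrence at 1 turn a value [K] into [K] or [-K], or into 2 plus one of these
    when the sign of odd index is negative. As [K] is even, [K] and [-K] agree modulo 4. *)
Lemma kneading_poly_at1 e n : ~~ odd n -> exists z : int,
  (kneading_poly e n).[1] = (\sum_(i < n) (odd i && e i))%:Z * 2 + z * 4.
Proof.
move=> even_n; rewrite -(odd_double_half n) (negPf even_n) add0n.
elim: n./2 => [|m [z IHm]]; first by exists 0; rewrite horner0 big_ord0.
rewrite doubleS !big_ord_recr /= odd_double /= addn0.
set S := (\sum_(i < _) _)%N in IHm *; set K := kneading_poly e _ in IHm *.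
rewrite !(hornerE, IHm) PoszD.
case: (e m.*2) (e m.*2.+1) => [] [] /=; rewrite ?expr0 ?expr1.
- by exists z; ring.
- by exists (- z - S%:Z); ring.
- by exists (- z - S%:Z); ring.
- by exists z; ring.
Qed.

Lemma kneading_poly_eisenstein (e : nat -> bool) k : (0 < k)%N ->
  odd (\sum_(i < 2 ^ k) (odd i && e i)) ->
  exists2 P : {poly int}, eisenstein_at1 P &
    exists2 s : int, s != 0 & P = s *: kneading_poly e (2 ^ k).
Proof.
move=> k0 oddS; set n := (2 ^ k)%N in oddS *; set K := kneading_poly e n.
have n0 : (0 < n)%N by rewrite expn_gt0.
have szK : size K = n by rewrite size_kneading_poly.
have nK : `|lead_coef K| = 1 by rewrite lead_coefE szK kneading_poly_coef ltn_predL n0.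
have lK2 : lead_coef K * lead_coef K = 1 by move: nK; case: (lead_coef K) => [[|[]]|[|]].
have lK0 : lead_coef K != 0 by rewrite -normr_eq0 nK.
(* The leading coefficient is 1 or -1, so multiplying by it makes [K] monic. *)
exists (lead_coef K *: K); last by exists (lead_coef K).
have even_n : ~~ odd n by rewrite oddX orbF -lt0n k0.
split.
- by rewrite monicE lead_coefZ lK2.
- rewrite size_scale // szK map_polyZ /= kneading_poly_mod2.
  have -> : (lead_coef K)%:~R = 1 :> 'F_2.
    have := nK; case: (lead_coef K) => [[|[]]|[|]] // _; exact/val_inj.
  by rewrite scale1r.
- have [z Kz] := kneading_poly_at1 e even_n.
  rewrite hornerZ -/K Kz; move: oddS nK; set S := (\sum_(_ < _) _)%N => oddS.
  case: (lead_coef K) => [[|[]]|[|]] //= _; apply/negP => /dvdzP[q].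
    by move: oddS; lia.
  by move: oddS; lia.
Qed.

(** * Entropy of tent maps *)

Section Tent.
Variable R : realType.
Implicit Types (l x y p : R).

Definition tent l x := 1 - l * `|x|.

Lemma tent_stable l x : 1 <= l <= 2 -> -1 <= x <= 1 -> -1 <= tent l x <= 1.
Proof.
move=> /andP[l1 l2] /andP[x1 x2]; rewrite /tent.
have : `|x| <= 1 by rewrite ler_norml x1 x2.
by have := normr_ge0 x; move: `|x| => a a0 a1; apply/andP; split; nra.
Qed.

Lemma iter_tent_stable l n x : 1 <= l <= 2 -> -1 <= x <= 1 ->
  -1 <= iter n (tent l) x <= 1.
Proof. by move=> l12 x1; elim: n => //= n; exact: tent_stable. Qed.

Lemma tent_dist l x y : 0 <= l -> `|tent l x - tent l y| = l * `| `|x| - `|y| |.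
Proof.
move=> l0; rewrite /tent (_ : _ - _ = l * (`|y| - `|x|)); last by ring.
by rewrite normrM ger0_norm // distrC.
Qed.

Lemma tent_dist_same_side l x y : 0 <= l ->
  (x <= 0 /\ y <= 0) \/ (0 <= x /\ 0 <= y) ->
  `|tent l x - tent l y| = l * `|x - y|.
Proof.
move=> l0; rewrite tent_dist // => -[[x0 y0]|[x0 y0]].
  by rewrite (ler0_norm x0) (ler0_norm y0) opprK addrC distrC.
by rewrite (ger0_norm x0) (ger0_norm y0).
Qed.

Lemma iter_tent_lipschitz l n x y : 0 <= l ->
  `|iter n (tent l) x - iter n (tent l) y| <= l ^+ n * `|x - y|.
Proof.
move=> l0; elim: n => [|n IHn]; first by rewrite mul1r.
rewrite !iterS tent_dist // exprS -mulrA ler_wpM2l //.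
by apply: le_trans IHn; exact: ler_dist_dist.
Qed.

Lemma iter_tent_one_sided l m p : 1 < l -> exists2 e, 0 < e & forall x y,
  (p - e <= x <= p /\ p - e <= y <= p) \/ (p <= x <= p + e /\ p <= y <= p + e) ->
  `|iter m (tent l) x - iter m (tent l) y| = l ^+ m * `|x - y|.
Proof.
move=> l1; have l0 : 0 < l by lra.
elim: m p => [|m IHm] p.
  by exists 1 => // x y _; rewrite mul1r.
have [e' e'0 He'] := IHm (tent l p).
(* [q] is the distance from [p] to the fold. At [p = 0] each side is already monotone and 1 is a
   dummy value. *)
pose q := if p == 0 then 1 else `|p|.
have q0 : 0 < q by rewrite /q; case: eqVneq => // pn0; rewrite normr_gt0.
pose e := Num.min (e' / l) q.
have e0 : 0 < e by rewrite lt_min q0 divr_gt0.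
have ele : l * e <= e' by rewrite mulrC -ler_pdivlMr // ge_min lexx.
have eq : p != 0 -> e <= `|p|.
  by rewrite /e /q => /negPf ->; rewrite ge_min lexx orbT.
exists e => // x y xy; rewrite !iterSr exprSr -mulrA -tent_dist_same_side ?(ltW l0) //.
  apply: He'; rewrite /tent; have [pp|pp] := ltrP 0 p.
    have := eq (lt0r_neq0 pp); rewrite (gtr0_norm pp) => ep.
    case: xy => -[/andP[a b] /andP[c d]].
      have xx : 0 <= x by lra.
      have yy : 0 <= y by lra.
      by rewrite !ger0_norm //; right; split; apply/andP; split; nra.
    have xx : 0 <= x by lra.
    have yy : 0 <= y by lra.
    by rewrite !ger0_norm //; left; split; apply/andP; split; nra.
  have [p0|pn0] := eqVneq p 0.
    rewrite p0 normr0 mulr0 subr0; left; rewrite p0 in xy.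
    have bnd z : `|z| <= e -> 1 - e' <= 1 - l * `|z| <= 1.
      by have := normr_ge0 z; move: `|z| => a *; apply/andP; split; nra.
    by split; apply: bnd; rewrite ler_norml; case: xy => -[]; lra.
  have := eq pn0; rewrite (ler0_norm pp) => ep.
  case: xy => -[/andP[a b] /andP[c d]].
    have xx : x <= 0 by lra.
    have yy : y <= 0 by lra.
    by rewrite !ler0_norm //; left; split; apply/andP; split; nra.
  have xx : x <= 0 by lra.
  have yy : y <= 0 by lra.
  by rewrite !ler0_norm //; right; split; apply/andP; split; nra.
have [p0|pn0] := eqVneq p 0.
  by rewrite p0 in xy; case: xy => -[]; lra.
have := eq pn0; have [pp|pp] := ltrP 0 p.
  by rewrite (gtr0_norm pp) => ep; right; case: xy => -[]; lra.
by rewrite (ler0_norm pp) => ep; left; case: xy => -[]; lra.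
Qed.

(* On small intervals the iterate has at most one fold, located at [t]. *)
Lemma iter_tent_one_fold l m : 1 < l -> exists2 e, 0 < e & forall x, exists t,
  forall y z, `|x - y| <= e -> `|x - z| <= e ->
    (y <= t /\ z <= t) \/ (t <= y /\ t <= z) ->
    `|iter m (tent l) y - iter m (tent l) z| = l ^+ m * `|y - z|.
Proof.
move=> l1; have l0 : 0 < l by lra.
elim: m => [|m [e2 e20 H2]]; first by exists 1 => // x; exists 0 => y z *; rewrite mul1r.
have [e1 e10 H1] := iter_tent_one_sided m 1 l1.
(* If [|x| <= e], points within [e] of [x] have modulus at most [2 * e], and their images stay
   within [e1] of the maximum 1, on its left. *)
pose e := Num.min (e1 / l / 2) (e2 / l).
have e0 : 0 < e by rewrite lt_min !divr_gt0.
have ee1 : 2 * l * e <= e1.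
  have : e <= e1 / l / 2 by rewrite ge_min lexx.
  by rewrite !ler_pdivlMr //; lra.
have ee2 : l * e <= e2.
  by rewrite mulrC -ler_pdivlMr // ge_min lexx orbT.
exists e => // x; have [xe|ex] := lerP `|x| e.
  exists 0 => y z xy xz yz; rewrite !iterSr exprSr -mulrA -tent_dist_same_side ?(ltW l0) //.
  have bnd w : `|x - w| <= e -> 1 - e1 <= tent l w <= 1.
    move=> xw; have w2 : `|w| <= 2 * e.
      have := ler_distD x 0 w; rewrite !sub0r !normrN; lra.
    rewrite /tent; have := normr_ge0 w; move: `|w| w2 => a *.
    by apply/andP; split; nra.
  by apply: H1; left; split; apply: bnd.
have [t1 Ht1] := H2 (tent l x).
(* Here [s] is the sign of [x]: away from 0 the tent map is affine, and the fold [t1] found at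
   [tent l x] is pulled back to its preimage [s * ((1 - t1) / l)] on the side of [x]. *)
have key s y z : s ^+ 2 = 1 -> 0 <= s * x -> 0 <= s * y -> 0 <= s * z ->
    `|x - y| <= e -> `|x - z| <= e ->
    (y <= s * ((1 - t1) / l) /\ z <= s * ((1 - t1) / l)) \/
    (s * ((1 - t1) / l) <= y /\ s * ((1 - t1) / l) <= z) ->
    `|iter m.+1 (tent l) y - iter m.+1 (tent l) z| = l ^+ m.+1 * `|y - z|.
  move=> s2 sx sy sz xy xz yz.
  have ss : `|s| = 1 by apply/eqP; rewrite -sqrp_eq1 ?normr_ge0 // -normrX s2 normr1.
  have nE w : 0 <= s * w -> `|w| = s * w.
    by move=> sw; rewrite -[LHS]mul1r -ss -normrM ger0_norm.
  have dE w w' : 0 <= s * w -> 0 <= s * w' -> `|tent l w - tent l w'| = l * `|w - w'|.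
    move=> sw sw'; rewrite tent_dist ?(nE w) ?(nE w') ?(ltW l0) //.
    by rewrite -mulrBr normrM ss mul1r.
  rewrite !iterSr exprSr -mulrA -dE //; apply: Ht1.
  - by rewrite dE // (le_trans _ ee2) // ler_wpM2l // ltW.
  - by rewrite dE // (le_trans _ ee2) // ler_wpM2l // ltW.
  have tl : l * ((1 - t1) / l) = 1 - t1 by rewrite mulrCA divff ?mulr1 // gt_eqF.
  rewrite /tent (nE y) // (nE z) //; move: (_ / l) tl yz => t tl.
  have [->|->] : s = 1 \/ s = -1.
    have : (s - 1) * (s + 1) = 0 by rewrite -subr_sqr s2; ring.
    by move/eqP; rewrite mulf_eq0 subr_eq0 addr_eq0 => /orP[] /eqP; tauto.
  - by rewrite !mul1r; case=> -[? ?]; [right|left]; split; nra.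
  - by rewrite !mulN1r; case=> -[? ?]; [left|right]; split; nra.
have [x0|x0] := lerP 0 x.
  exists (1 * ((1 - t1) / l)) => y z xy xz yz; move: ex; rewrite (ger0_norm x0) => ex.
  move: (xy) (xz); rewrite !ler_distl => /andP[? ?] /andP[? ?].
  by apply: (key 1) => //; rewrite ?expr1n // ?mul1r; lra.
exists (-1 * ((1 - t1) / l)) => y z xy xz yz; move: ex; rewrite (ltr0_norm x0) => ex.
move: (xy) (xz); rewrite !ler_distl => /andP[? ?] /andP[? ?].
by apply: (key (-1)) => //; rewrite ?sqrrN ?expr1n // ?mulN1r; lra.
Qed.

End Tent.

(** Greedy selection: keep the head, discard the at most [B] elements close to it (itself included),
    and recurse. *)
Lemma separated_subseq (T : eqType) (close : rel T) (B : nat) (s : seq T) :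
  reflexive close -> symmetric close -> uniq s ->
  (forall x, x \in s -> (count (close x) s <= B)%N) ->
  exists2 e, subseq e s & (pairwise (fun x y => ~~ close x y) e) &&
    (size s <= B * size e)%N.
Proof.
move=> cxx cC; have [n] := ubnP (size s); elim: n s => // n IHn [|x s] /=.
  by move=> *; exists [::].
rewrite ltnS => szs /andP[xs us] B_ge.
have [||| e es /andP[pe le]] := IHn [seq y <- s | ~~ close x y].
- by apply: leq_ltn_trans szs; rewrite size_filter count_size.
- by rewrite filter_uniq.
- move=> y; rewrite mem_filter => /andP[_ ys].
  apply: leq_trans (B_ge y _); last by rewrite inE ys orbT.
  apply: (@leq_trans (count (close y) s)); last exact: leq_addl.
  by rewrite count_filter; apply: sub_count => z /andP[].
exists (x :: e).
  by rewrite /= eqxx; apply: subseq_trans es (filter_subseq _ _).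
rewrite /= pe andbT; apply/andP; split.
  by apply/allP => y /(mem_subseq es); rewrite mem_filter => /andP[].
have := B_ge x (mem_head _ _); rewrite /= cxx mulnS => leB.
have szE : size s = (count (close x) s + size [seq y <- s | ~~ close x y])%N.
  by rewrite size_filter (count_predC (close x)).
by move: le leB; rewrite szE; move: (B * _)%N => Be; lia.
Qed.

Section Entropy.
Variable R : realType.
Implicit Types (l x y p : R).

Lemma bowen_dist_ge (f : R -> R) n i x y : (i < n)%N ->
  `|iter i f x - iter i f y| <= bowen_dist f n x y.
Proof. by move=> lt_in; rewrite /bowen_dist (le_bigmax _ _ (Ordinal lt_in)). Qed.

Lemma bowen_dist_sym (f : R -> R) n x y : bowen_dist f n x y = bowen_dist f n y x.
Proof. by apply: eq_bigr => i _; rewrite distrC. Qed.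

Lemma bowen_dist_refl (f : R -> R) n x : bowen_dist f n x x = 0.
Proof.
rewrite /bowen_dist; elim/big_ind : _ => // [a b -> ->|i _]; first by rewrite maxxx.
by rewrite subrr normr0.
Qed.

Lemma bowen_dist_tent_le l n x y : 1 <= l ->
  bowen_dist (tent l) n x y <= l ^+ n * `|x - y|.
Proof.
move=> l1; have l0 : 0 <= l by lra.
apply: bigmax_le => [|i _]; first by rewrite mulr_ge0 ?exprn_ge0.
apply: le_trans (iter_tent_lipschitz _ _ _ l0) _.
by rewrite ler_wpM2r // ler_weXn2l // ltnW.
Qed.

(** Code a point by the side of the fold on which its orbit lies at times [0, m, 2 m, ...]. Two
    points with the same code have their distance multiplied by [l ^ m] in each of the [N] blocks,
    so it would end above 2, the length of [[-1, 1]]. Hence there are no more points than codes. *)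
Lemma bowen_close_count l (m : nat) (e : R) : 1 < l <= 2 -> (0 < m)%N ->
  (forall x, exists t, forall y z, `|x - y| <= e -> `|x - z| <= e ->
    (y <= t /\ z <= t) \/ (t <= y /\ t <= z) ->
    `|iter m (tent l) y - iter m (tent l) z| = l ^+ m * `|y - z|) ->
  forall (N n : nat) x (s : seq R), (m * N <= n)%N -> uniq s ->
    (forall y, y \in s -> -1 <= y <= 1) ->
    (forall y z, y \in s -> z \in s -> y != z -> 2 < l ^+ (m * N) * `|y - z|) ->
    (count (fun y => (bowen_dist (tent l) n x y <= e)%R) s <= 2 ^ N)%N.
Proof.
move=> /andP[l1 l2] m0 /choice[t Ht] N n x s leN us s1 sp.
have l0 : 0 < l by lra.
pose T := tent l.
pose code y := [ffun j : 'I_N => iter (m * j) T y <= t (iter (m * j) T x)].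
rewrite -size_filter; set s' := [seq y <- s | _].
have us' : uniq s' by rewrite filter_uniq.
suff inj : {in s' &, injective code}.
  rewrite -(size_map code); have /card_uniqP <- : uniq (map code s') by rewrite map_inj_in_uniq.
  by apply: leq_trans (max_card _) _; rewrite card_ffun card_bool card_ord.
move=> y z; rewrite !mem_filter => /andP[cy ys] /andP[cz zs] /ffunP eq_code.
apply/eqP; apply: contraT => neq_yz.
have dist j : (j <= N)%N ->
    `|iter (m * j) T y - iter (m * j) T z| = l ^+ (m * j) * `|y - z|.
  elim: j => [|j IHj] ltjN; first by rewrite muln0 expr0 mul1r.
  rewrite mulnS !iterD exprD -mulrA -IHj ?(ltnW ltjN) //; apply: (Ht (iter (m * j) T x)).
  - apply: le_trans cy; apply: bowen_dist_ge; apply: leq_trans leN.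
    by rewrite ltn_pmul2l.
  - apply: le_trans cz; apply: bowen_dist_ge; apply: leq_trans leN.
    by rewrite ltn_pmul2l.
  have := eq_code (Ordinal ltjN); rewrite !ffunE /=.
  case: (lerP (iter _ T y)); case: (lerP (iter _ T z)) => // a b _; first by left.
  by right; split; apply: ltW.
have := sp _ _ ys zs neq_yz; rewrite -dist // ltNge => /negP; case.
have l12 : 1 <= l <= 2 by rewrite l2 ltW.
have /andP[a b] := iter_tent_stable (m * N) l12 (s1 y ys).
have /andP[c d] := iter_tent_stable (m * N) l12 (s1 z zs).
by rewrite ler_norml /T; lra.
Qed.

Lemma separated_tent_exists l (m : nat) : 1 < l <= 2 -> (0 < m)%N ->
  exists2 e : R, 0 < e & forall N n, (m * N <= n)%N ->
    exists2 s, bowen_separated (tent l) `[-1, 1] n e s &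
      l ^+ (m * N) <= 3 * (2 ^+ N * (size s)%:R).
Proof.
move=> l12 m0; have [l1 l2] := andP l12; have l0 : 0 < l by lra.
have [e e0 He] := iter_tent_one_fold m l1.
exists e => // N n leN; set A := l ^+ _.
have A0 : 0 < A by rewrite exprn_gt0.
(* The multiples of [3 / A] in [[0, 1]] are more than [A / 3] in number, and their mutual distances
   are at least [3 / A > 2 / A], as the count of close points requires. *)
pose L := (Num.truncn (A / 3)).+1.
pose g (k : nat) : R := k%:R * (3 / A).
have g_inj : injective g.
  have A30 : 3 / A != 0 by rewrite mulf_neq0 // invr_eq0 gt_eqF.
  by move=> i j /(mulIf A30)/eqP; rewrite eqr_nat => /eqP.
pose s := map g (iota 0 L).
have us : uniq s by rewrite map_inj_uniq ?iota_uniq.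
have s1 y : y \in s -> 0 <= y <= 1.
  move=> /mapP[k]; rewrite mem_iota add0n ltnS => /andP[_ kL] ->.
  have k0 : 0 <= k%:R :> R by rewrite ler0n.
  rewrite /g mulr_ge0 ?divr_ge0 ?(ltW A0) //= mulrA ler_pdivrMr // mul1r.
  have : k%:R <= A / 3.
    apply: le_trans (_ : (Num.truncn (A / 3))%:R <= _); first by rewrite ler_nat.
    by rewrite truncn_le // divr_ge0 // ltW.
  by rewrite ler_pdivlMr.
have sp y z : y \in s -> z \in s -> y != z -> 2 < A * `|y - z|.
  move=> /mapP[i _ ->] /mapP[j _ ->] neq.
  have {}neq : i != j by apply: contraNneq neq => ->.
  rewrite /g -mulrBl normrM [`|3 / A|]gtr0_norm ?divr_gt0 // mulrCA.
  rewrite [A * _]mulrC divfK ?gt_eqF //.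
  have : 1 <= `|i%:R - j%:R| :> R; last by lra.
  case: (ltngtP i j) neq => // ij _.
    by rewrite distrC -natrB ?(ltnW ij) // normr_nat ler1n subn_gt0.
  by rewrite -natrB ?(ltnW ij) // normr_nat ler1n subn_gt0.
have s2 y : y \in s -> -1 <= y <= 1 by move=> /s1/andP[]; lra.
pose close x y := bowen_dist (tent l) n x y <= e.
have [||||E Es /andP[pE leE]] := @separated_subseq _ close (2 ^ N) s.
- by move=> x; rewrite /close bowen_dist_refl ltW.
- by move=> x y; rewrite /close bowen_dist_sym.
- exact: us.
- by move=> x _; exact: (bowen_close_count l12 m0 He x leN us s2 sp).
have uE := subseq_uniq Es us.
exists E.
  split=> // [x xE|x y xE yE].
    by rewrite /= in_itv /=; apply: s2; apply: mem_subseq xE.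
  move/(pairwiseP 0): pE => pE neq.
  have := index_mem x E; have := index_mem y E; rewrite xE yE => iy ix.
  have ne : index x E != index y E.
    by apply: contraNneq neq => h; rewrite -(nth_index 0 xE) h nth_index.
  case: (ltngtP (index x E) (index y E)) ne => // lt _.
    by have := pE _ _ ix iy lt; rewrite !nth_index // /close -ltNge.
  by have := pE _ _ iy ix lt; rewrite !nth_index // /close -ltNge bowen_dist_sym.
have : (L%:R : R) <= (2 ^ N * size E)%:R by rewrite ler_nat -[L](size_iota 0) -(size_map g).
rewrite natrM natrX => leL; apply: (@le_trans _ _ (3 * L%:R)); last by rewrite ler_wpM2l.
have : A / 3 < L%:R by rewrite truncnS_gt.
by rewrite ltr_pdivrMr // mulrC => /ltW.
Qed.

(** The Bowen distance is at most [l ^ n] times the usual one, so a cell of length [e / l ^ n]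
    contains at most one point of a separated set. *)
Lemma separated_tent_size_le l n (e : R) (s : seq R) : 1 <= l -> 0 < e ->
  bowen_separated (tent l) `[-1, 1] n e s -> (size s)%:R <= (2 / e + 1) * l ^+ n.
Proof.
move=> l1 e0 [us s1 sp]; have l0 : 0 < l by lra.
have A1 : 1 <= l ^+ n by rewrite exprn_ege1.
set A := l ^+ n in A1 *; have A0 : 0 < A by lra.
pose code x := Num.truncn ((x + 1) * (A / e)).
have gt0 x : x \in s -> 0 <= (x + 1) * (A / e).
  move=> /s1; rewrite /= in_itv /= => /andP[x0 _]; apply: mulr_ge0; [lra | by rewrite divr_ge0 // ltW].
have inj : {in s &, injective code}.
  move=> x y xs ys /eqP eq_code; apply/eqP; apply: contraT => neq.
  have := sp _ _ xs ys neq; rewrite ltNge => /negP; case.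
  apply: le_trans (bowen_dist_tent_le _ _ _ l1) _; rewrite -/A.
  have /andP[a b] := truncn_itv (gt0 x xs); have /andP[c d] := truncn_itv (gt0 y ys).
  have /eqP ec := eq_code; rewrite /code in ec; rewrite ec in a b.
  have : `|(x - y) * (A / e)| <= 1.
    rewrite (_ : (x - y) * _ = (x + 1) * (A / e) - (y + 1) * (A / e)); last by ring.
    by rewrite ler_norml; move: a b c d; rewrite -natr1; lra.
  by rewrite normrM [`|A / e|]gtr0_norm ?divr_gt0 // mulrA ler_pdivrMr // mul1r mulrC.
have sub : {subset map code s <= iota 0 (Num.truncn (2 * (A / e))).+1}.
  move=> _ /mapP[x xs ->]; rewrite mem_iota add0n ltnS /=.
  apply: le_truncn; apply: ler_wpM2r; first by rewrite divr_ge0 // ltW.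
  by move: (s1 x xs); rewrite /= in_itv /= => /andP[_]; lra.
have := uniq_leq_size _ sub; rewrite map_inj_in_uniq // us => /(_ isT).
rewrite size_map size_iota -(ler_nat R) => le; apply: le_trans le _.
have AE : 2 * (A / e) = 2 / e * A by rewrite mulrAC mulrA.
have : (Num.truncn (2 * (A / e)))%:R <= 2 / e * A.
  by rewrite -AE truncn_le // mulr_ge0 // divr_ge0 // ltW.
by rewrite -[X in _ -> X <= _]natr1 mulrDl mul1r; lra.
Qed.

End Entropy.

(** * The growth rate and the unimodality of tent maps *)

Section EntropyValue.
Variable R : realType.
Implicit Types (l x y p : R).

Lemma limn_esup_le_near (u : (\bar R)^nat) (a : R) :
  (forall e, 0 < e -> exists N, forall n, (N <= n)%N -> (u n <= (a + e)%:E)%E) ->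
  (limn_esup u <= a%:E)%E.
Proof.
move=> H; apply/lee_addgt0Pr => e e0; have [N HN] := H e e0.
apply: (@le_trans _ _ (ereal_sup (u @` [set n | (N <= n)%N]))).
  by apply: ereal_inf_lbound; exists [set n | (N <= n)%N] => //; exists N.
by apply: ge_ereal_sup => _ [n /= Nn <-]; rewrite -EFinD; exact: HN.
Qed.

Lemma limn_esup_ge_near (u : (\bar R)^nat) (a : R) :
  (forall e, 0 < e -> exists N, forall n, (N <= n)%N -> ((a - e)%:E <= u n)%E) ->
  (a%:E <= limn_esup u)%E.
Proof.
move=> H; apply: le_ereal_inf_tmp => _ [V [M _ MV] <-].
apply/lee_subgt0Pr => e e0; have [N HN] := H e e0.
apply: (@le_trans _ _ (u (maxn N M))); first by rewrite -EFinB HN // leq_maxl.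
by apply: ereal_sup_ubound; exists (maxn N M) => //; apply: MV => /=; exact: leq_maxr.
Qed.

Lemma separated_card_tent_le l n (e : R) : 1 <= l -> 0 < e ->
  (separated_card (tent l) `[(-1)%R, 1%R] n e <= ((2 / e + 1) * l ^+ n)%:E)%E.
Proof.
move=> l1 e0; apply: ge_ereal_sup => _ [s /= sep <-].
by rewrite lee_fin; exact: (separated_tent_size_le l1 e0 sep).
Qed.

Lemma entropy_at_tent_le l (e : R) : 1 <= l -> 0 < e ->
  (entropy_at (tent l) `[(-1)%R, 1%R] e <= (ln l)%:E)%E.
Proof.
move=> l1 e0; have l0 : 0 < l by lra.
set C := 2 / e + 1; have C1 : 1 <= C by rewrite lerDr divr_ge0 // ltW.
apply: limn_esup_le_near => d d0.
have [N HN] := exists_nat_ge (ln C / d).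
exists N.+1 => n Nn; have n0 : 0 < n%:R :> R by rewrite ltr0n (leq_trans _ Nn).
have P0 : 0 < C * l ^+ n by rewrite mulr_gt0 ?exprn_gt0 //; lra.
apply: (@le_trans _ _ ((n%:R^-1)%:E * lne (C * l ^+ n)%:E))%E.
  apply: lee_wpmul2l; first by rewrite lee_fin invr_ge0 ltW.
  have card0 : (0 <= separated_card (tent l) `[(-1)%R, 1%R] n e)%E.
    by apply: ereal_sup_ubound; exists [::] => //; split.
  by rewrite lee_lne ?in_itv /= ?leey ?andbT ?lee_fin ?(ltW P0) //; exact: separated_card_tent_le.
rewrite lne_EFin // -EFinM lee_fin lnM ?posrE ?exprn_gt0 //; last lra.
rewrite lnXn // mulrC ler_pdivrMr // -mulr_natr.
have := HN _ (ltnW Nn); rewrite ler_pdivrMr //; lra.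
Qed.

Lemma entropy_at_tent_ge l (m : nat) : 1 < l <= 2 -> (0 < m)%N ->
  exists2 e : R, 0 < e &
    ((ln l - ln 2 / m%:R)%:E <= entropy_at (tent l) `[(-1)%R, 1%R] e)%E.
Proof.
move=> l12 m0; have [l1 l2] := andP l12; have l0 : 0 < l by lra.
have [e e0 He] := separated_tent_exists l12 m0; exists e => //.
apply: limn_esup_ge_near => d d0.
have [N HN] := exists_nat_ge ((m%:R * ln l + ln 3) / d).
exists N.+1 => n Nn; have n0 : 0 < n%:R :> R by rewrite ltr0n (leq_trans _ Nn).
have mR : 0 < m%:R :> R by rewrite ltr0n.
(* Rounding [n] down to [m * q] loses at most [m * ln l] in the logarithm; together with [ln 3] this
   is at most [d * n] by the choice of [N]. *)
pose q := (n %/ m)%N.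
have qn : (m * q <= n)%N by rewrite mulnC leq_divM.
have nq : (n < m * q + m)%N by rewrite mulnC -mulSnr ltn_ceil.
have [s ss les] := He q n qn.
have sz0 : 0 < (size s)%:R :> R.
  rewrite lt_neqAle ler0n andbT; apply: contraTneq les => <-.
  by rewrite !mulr0 -ltNge exprn_gt0.
apply: (@le_trans _ _ ((n%:R^-1)%:E * lne (size s)%:R%:E))%E; last first.
  apply: lee_wpmul2l; first by rewrite lee_fin invr_ge0 ltW.
  have card_ge : ((size s)%:R%:E <= separated_card (tent l) `[(-1)%R, 1%R] n e)%E.
    by apply: ereal_sup_ubound; exists s.
  rewrite lee_lne // in_itv /= leey andbT ?lee_fin ?(ltW sz0) //.
  by apply: le_trans card_ge; rewrite lee_fin ltW.
rewrite lne_EFin // -EFinM lee_fin [leRHS]mulrC ler_pdivlMr //.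
have q20 : 0 < 2 ^+ q * (size s)%:R :> R by rewrite mulr_gt0 // exprn_gt0.
have := les; rewrite -ler_ln ?posrE ?exprn_gt0 ?mulr_gt0 //.
rewrite !lnM ?posrE ?exprn_gt0 // !lnXn // -![ln _ *+ _]mulr_natr natrM => ineq.
have := HN _ (ltnW Nn); rewrite ler_pdivrMr // => le3.
have L0 : 0 < ln l by rewrite ln_gt0.
have L2 : 0 < ln 2 :> R by rewrite ln_gt0 // ltr1n.
have nqR : n%:R <= m%:R * q%:R + m%:R :> R by rewrite -natrM -natrD ler_nat ltnW.
have qnR : m%:R * q%:R <= n%:R :> R by rewrite -natrM ler_nat.
have q_le : ln (2 : R) * q%:R <= ln 2 / m%:R * n%:R.
by rewrite -mulrA ler_wpM2l ?(ltW L2) // mulrC ler_pdivlMr // mulrC.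
rewrite !mulrBl; nra.
Qed.

Lemma topological_entropy_tent l : 1 < l <= 2 ->
  topological_entropy (tent l) `[(-1)%R, 1%R] = (ln l)%:E.
Proof.
move=> l12; have [l1 l2] := andP l12; apply/eqP; rewrite eq_le; apply/andP; split.
  by apply: ge_ereal_sup => _ [e /= e0 <-]; exact: (entropy_at_tent_le (ltW l1)).
apply/lee_subgt0Pr => d d0.
have [N HN] := exists_nat_ge (ln 2 / d).
(* Long blocks make the loss [ln 2 / m], caused by one fold per block, smaller than [d]. *)
have [e e0 He] := entropy_at_tent_ge l12 (ltn0Sn N).
apply: (@le_trans _ _ (entropy_at (tent l) `[(-1)%R, 1%R] e)); last first.
  by apply: ereal_sup_ubound; exists e.
apply: le_trans He; rewrite -EFinB lee_fin lerD2l lerN2.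
by rewrite ler_pdivrMr ?ltr0Sn // mulrC -ler_pdivrMr // HN.
Qed.

Lemma growth_rate_tent l : 1 < l <= 2 -> growth_rate (tent l) `[(-1)%R, 1%R] = l%:E.
Proof.
move=> l12; rewrite /growth_rate topological_entropy_tent //= lnK // posrE.
by case/andP: l12; lra.
Qed.

Lemma continuous_tent l : continuous (tent l).
Proof.
move=> x; apply: cvgB; first exact: cvg_cst.
by apply: cvgM; [exact: cvg_cst | exact: norm_continuous].
Qed.

Lemma unimodal_tent l : 1 < l <= 2 -> unimodal (tent l) (-1) 1 0.
Proof.
move=> l12; have [l1 l2] := andP l12; split.
- by apply: continuous_subspaceT; exact: continuous_tent.
- move=> x; rewrite !in_itv /=; apply: tent_stable; lra.
- split; first by lra.
  left; apply/nbhs_ballP; exists 1 => //= x _; rewrite /tent normr0 mulr0 subr0.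
  by have := normr_ge0 x; nra.
move=> c [_ ext]; apply/eqP; apply: contraT => c0.
have c0' : 0 < `|c| by rewrite normr_gt0.
(* For [c != 0], the values at [c * (1 + h)] and [c * (1 - h)] lie strictly below and above the
   value at [c], which excludes both kinds of extremum. *)
have near_points (P : R -> Prop) : (\forall x \near c, P x) ->
    exists2 h, 0 < h < 1 & P (c * (1 + h)) /\ P (c * (1 - h)).
  move=> /nbhs_ballP[d /= d0 Hd].
  pose h := Num.min (1 / 2) (d / (2 * `|c|)).
  have h0 : 0 < h by rewrite lt_min !divr_gt0 ?mulr_gt0.
  have h1 : h <= 1 / 2 by rewrite ge_min lexx.
  have h2 : `|c| * h < d.
    have : h <= d / (2 * `|c|) by rewrite ge_min lexx orbT.
    by rewrite ler_pdivlMr ?mulr_gt0 //; nra.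
  exists h; first by lra.
  by split; apply: Hd; rewrite /ball /= mulrDr mulr1 opprD addrA subrr add0r normrN
    normrM ?normrN (gtr0_norm h0).
case: ext => /near_points[h /andP[h0 h1] [H1 H2]];
  have lch : 0 < l * `|c| * h by rewrite !mulr_gt0 //; lra.
  move: H2; rewrite /tent normrM [`|1 - h|]ger0_norm; last by lra.
  by lra.
move: H1; rewrite /tent normrM [`|1 + h|]ger0_norm; last by lra.
by lra.
Qed.

End EntropyValue.

(** * The critical orbit as a function of the slope *)

Section SlopeDependence.
Variable R : realType.
Implicit Types (l x y p a b c d s t C E : R).

Definition crit_orbit l k : R := iter k (tent l) 0.
Local Notation X := crit_orbit.

Lemma crit_orbitS l k : X l k.+1 = 1 - l * `|X l k|.
Proof. by []. Qed.

Lemma crit_orbit1 l : X l 1 = 1.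
Proof. by rewrite /crit_orbit /= /tent normr0 mulr0 subr0. Qed.

Lemma crit_orbit_bound l k : 1 <= l <= 2 -> `|X l k| <= 1.
Proof. by move=> l12; rewrite ler_norml; apply: iter_tent_stable => //; rewrite oppr_le0 ler01. Qed.

Lemma continuous_crit_orbit k : continuous (X ^~ k).
Proof.
elim: k => [|k IHk] x; first exact: cvg_cst.
apply: cvgB; first exact: cvg_cst.
apply: cvgM; first exact: cvg_id.
by apply: cvg_norm; exact: IHk.
Qed.

Lemma exists_zero_between (H : R -> R) s t : continuous H -> H s < 0 < H t ->
  exists2 r, Num.min s t <= r <= Num.max s t & H r = 0.
Proof.
move=> cH /andP[s0 t0]; have [st|ts] := leP s t.
  have [||r rst Hr] := @IVT _ H s t 0 st; first exact: continuous_subspaceT.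
    by rewrite ge_min le_max (ltW s0) (ltW t0) orbT.
  by exists r => //; move: rst; rewrite in_itv.
have [||r rst Hr] := @IVT _ H t s 0 (ltW ts); first exact: continuous_subspaceT.
  by rewrite ge_min le_max (ltW s0) (ltW t0) orbT.
by exists r => //; move: rst; rewrite in_itv.
Qed.

(** On one side of 0, absolute values keep the distance between the two points. The slope multiplies
    it by at least [a], and the change of slope costs at most [|s - t|] because orbits stay in
    [[-1, 1]]. *)
Lemma crit_orbit_spread a s t k : 1 <= a -> a <= s <= 2 -> a <= t <= 2 ->
  0 <= X s k * X t k ->
  a * `|X s k - X t k| - `|s - t| <= `|X s k.+1 - X t k.+1|.
Proof.
move=> a1 /andP[as_ s2] /andP[at_ t2] same; rewrite !crit_orbitS.
have bt : `|X t k| <= 1 by apply: crit_orbit_bound; lra.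
have -> : 1 - s * `|X s k| - (1 - t * `|X t k|) =
    - (s * (`|X s k| - `|X t k|) + (s - t) * `|X t k|) by ring.
have nE : `| `|X s k| - `|X t k| | = `|X s k - X t k|.
  have [xs|xs] := lerP 0 (X s k); have [xt|xt] := lerP 0 (X t k) => //.
  - by rewrite (ger0_norm xs) (ger0_norm xt).
  - have -> : X s k = 0 by apply/eqP; rewrite eq_le xs andbT; nra.
    by rewrite normr0 !sub0r !normrN normr_id.
  - have -> : X t k = 0 by apply/eqP; rewrite eq_le xt andbT; nra.
    by rewrite normr0 !subr0 normr_id.
  - by rewrite (ltr0_norm xs) (ltr0_norm xt) opprK addrC distrC.
rewrite normrN; have := lerB_normD (s * (`|X s k| - `|X t k|)) ((s - t) * `|X t k|).
rewrite !normrM nE normr_id (ger0_norm (_ : 0 <= s)); last by lra.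
have := normr_ge0 (X s k - X t k); have := normr_ge0 (s - t).
have := normr_ge0 (X t k); nra.
Qed.

(** A derivative-free form of the bound [|d X / d l| >= C] on an interval where [X] is monotone in
    the slope. *)
Definition expands k a b C := forall s t, a <= s -> s < t -> t <= b ->
  C * (t - s) <= `|X t k - X s k|.

(** Expansion prevents [X k] from vanishing at both ends of the interval; near an end where it does
    not vanish its sign is constant, and [crit_orbit_spread] applies. *)
Lemma expandsS a al be k C : 1 <= a -> a <= al -> al < be -> be <= 2 -> 0 < C ->
  expands k al be C ->
  exists al' be', [/\ al <= al', al' < be', be' <= be &
                      expands k.+1 al' be' (a * C - 1)].
Proof.
move=> a1 aal albe be2 C0 ex.
suff [al' [be' [h1 h2 h3 same]]] : exists al' be', [/\ al <= al', al' < be', be' <= be &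
    forall s t, al' <= s <= be' -> al' <= t <= be' -> 0 <= X s k * X t k].
  exists al', be'; split=> // s t s1 st t2.
  have C1 := ex s t (le_trans h1 s1) st (le_trans t2 h3).
  have := @crit_orbit_spread a t s k a1.
  rewrite (_ : a <= t <= 2); last by lra.
  rewrite (_ : a <= s <= 2); last by lra.
  move=> /(_ isT isT); rewrite same; try lra.
  by move=> /(_ isT); rewrite (gtr0_norm (_ : 0 < t - s)); [nra|lra].
have near p : X p k != 0 -> exists2 d, 0 < d &
    forall s t, `|p - s| < d -> `|p - t| < d -> 0 <= X s k * X t k.
  move=> p0; have p0' : 0 < `|X p k| by rewrite normr_gt0.
  have := @continuous_crit_orbit k p => /cvgr_dist_lt/(_ _ p0')/nbhs_ballP[d /= d0 Hd].
  exists d => // s t ps pt; move: (Hd s ps) (Hd t pt) => /=.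
  rewrite !ltr_distl; have [xp|xp] := lerP 0 (X p k); first by rewrite ?ger0_norm //; nra.
  by rewrite ?ltr0_norm //; nra.
have nz : X al k != 0 \/ X be k != 0.
  apply/orP; rewrite -negb_and; apply/negP => /andP[/eqP h1 /eqP h2].
  by have := ex al be (lexx _) albe (lexx _); rewrite h1 h2 subrr normr0; nra.
case: nz => /near[d d0 Hd].
  pose e := Num.min (be - al) (d / 2).
  have e0 : 0 < e by rewrite lt_min; apply/andP; split; lra.
  have e1 : e <= be - al by rewrite ge_min lexx.
  have e2 : e <= d / 2 by rewrite ge_min lexx orbT.
  exists al, (al + e); split; [lra..|] => s t s1 t1.
  by apply: Hd; rewrite ltr_distl; lra.
pose e := Num.min (be - al) (d / 2).
have e0 : 0 < e by rewrite lt_min; apply/andP; split; lra.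
have e1 : e <= be - al by rewrite ge_min lexx.
have e2 : e <= d / 2 by rewrite ge_min lexx orbT.
exists (be - e), be; split; [lra..|] => s t s1 t1.
by apply: Hd; rewrite ltr_distl; lra.
Qed.

(** The recursion [C -> a C - 1] grows only from above its fixed point [1 / (a - 1)]. Above the
    golden ratio the third iterate starts there; below it the signs are known up to the fifth
    iterate, which is used instead. *)
Lemma expands_start a b : 0 < a -> 2 < a ^+ 2 -> a < b -> b <= 2 ->
  exists k al be C, [/\ a <= al, al < be, be <= b, expands k al be C &
    1 < C * (a - 1)].
Proof.
move=> a0 a2 ab b2; have a14 : 141 / 100 < a by nra.
have X2 l : X l 2 = 1 - l by rewrite crit_orbitS crit_orbit1 normr1 mulr1.
have X3 l : 1 < l -> X l 3 = 1 + l - l ^+ 2.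
  by move=> l1; rewrite crit_orbitS X2 ltr0_norm; [ring | lra].
have [gold|gold] := lerP 0 (a ^+ 2 - a - 1).
  exists 3%N, a, b, (2 * a - 1); split=> // [s t s1 st t2|].
    rewrite !X3; try lra.
    rewrite [X in `|X|](_ : _ = - ((t - s) * (t + s - 1))); last by ring.
    rewrite normrN normrM !gtr0_norm; nra.
  nra.
have [be [abe beb golden]] : exists be, [/\ a < be, be <= b & be ^+ 2 - be - 1 <= 0].
  pose e := Num.min (b - a) ((1 + a - a ^+ 2) / 5).
  have e0 : 0 < e by rewrite lt_min; apply/andP; split; lra.
  have e1 : e <= b - a by rewrite ge_min lexx.
  have e2 : e <= (1 + a - a ^+ 2) / 5 by rewrite ge_min lexx orbT.
  exists (a + e); split; [lra..|nra].
have X4 l : a <= l <= be -> X l 4 = 1 - l * (1 + l - l ^+ 2).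
  move=> /andP[l1 l2]; rewrite crit_orbitS X3; last by lra.
  by rewrite ger0_norm //; nra.
have X4E l : 1 - l * (1 + l - l ^+ 2) = (l - 1) * (l ^+ 2 - 1) by ring.
have X5 l : a <= l <= be -> X l 5 = 1 - l * ((l - 1) * (l ^+ 2 - 1)).
  move=> /andP[l1 l2]; rewrite crit_orbitS X4 ?l1 // X4E ger0_norm //.
  by apply: mulr_ge0; nra.
exists 5%N, a, be, (a * ((3 * a + 1) * (a - 1))); split=> // [s t s1 st t2|].
  rewrite !X5; try lra.
  set A := fun l : R => (l - 1) * (l ^+ 2 - 1).
  have As : 0 <= A s by apply: mulr_ge0; nra.
  (* [(3 * a + 1) * (a - 1)] is the derivative of [A] at [a], its minimum on the interval. *)
  have dA : (3 * a + 1) * (a - 1) * (t - s) <= A t - A s.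
    have -> : A t - A s = (t ^+ 2 + t * s + s ^+ 2 - t - s - 1) * (t - s) by rewrite /A; ring.
    rewrite ler_wpM2r; [by []|lra|].
    have : a * t <= t ^+ 2 by nra.
    have : a * s <= t * s by nra.
    have : a * s <= s ^+ 2 by nra.
    have : (a - 1) * a <= (a - 1) * t by rewrite ler_wpM2l; lra.
    have : (2 * a - 1) * a <= (2 * a - 1) * s by rewrite ler_wpM2l; lra.
    lra.
  have dA0 : 0 <= A t - A s by apply: le_trans dA; rewrite !mulr_ge0; lra.
  rewrite -/(A t) -/(A s) [X in `|X|](_ : _ = - (t * (A t - A s) + (t - s) * A s)); last by ring.
  rewrite normrN ger0_norm; last by apply: addr_ge0; apply: mulr_ge0; lra.
  have : 0 <= (t - s) * A s by apply: mulr_ge0; lra.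
  have : a * (A t - A s) <= t * (A t - A s) by apply: ler_wpM2r; lra.
  have : a * ((3 * a + 1) * (a - 1) * (t - s)) <= a * (A t - A s) by apply: ler_wpM2l; lra.
  lra.
have : 7 < a * (3 * a + 1) by nra.
have : 168 / 1000 < (a - 1) ^+ 2 by nra.
rewrite (_ : a * _ * _ = a * (3 * a + 1) * (a - 1) ^+ 2); last by ring.
move: (a * _) (_ ^+ 2) => u v; nra.
Qed.

Lemma expands_large a b B : 0 < a -> 2 < a ^+ 2 -> a < b -> b <= 2 ->
  exists k al be C, [/\ a <= al, al < be, be <= b, expands k al be C & B <= C].
Proof.
move=> a0 a2 ab b2; have a1 : 1 < a by nra.
have [k0 [al0 [be0 [C0 [? ? ? ex0 C01]]]]] := expands_start a0 a2 ab b2.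
pose th := (a - 1)^-1; have th0 : 0 < th by rewrite invr_gt0; lra.
have the : th * (a - 1) = 1 by rewrite mulVf // subr_eq0 gt_eqF.
have C0th : th < C0 by rewrite /th -[ltLHS]mul1r ltr_pdivrMr //; lra.
have iterate j : exists k al be C, [/\ a <= al, al < be, be <= b, expands k al be C &
    a ^+ j * (C0 - th) <= C - th].
  elim: j => [|j [k [al [be [C [h1 h2 h3 ex hC]]]]]].
    by exists k0, al0, be0, C0; split=> //; rewrite mul1r.
  have Cth : 0 < C - th by apply: lt_le_trans hC; rewrite mulr_gt0 ?exprn_gt0 //; lra.
  have [||al' [be' [h1' h2' h3' ex']]] := expandsS (ltW a1) h1 h2 _ _ ex; try lra.
  exists k.+1, al', be', (a * C - 1); split=> //; try lra.
  rewrite exprS -mulrA.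
  have : a * (a ^+ j * (C0 - th)) <= a * (C - th) by rewrite ler_wpM2l // ltW.
  lra.
have [N HN] := exists_expr_ge ((B - th) / (C0 - th)) a1.
have [k [al [be [C [h1 h2 h3 ex hC]]]]] := iterate N.
exists k, al, be, C; split=> //.
have := HN N (leqnn N); rewrite ler_pdivrMr; lra.
Qed.

Definition tent_fix l := (1 + l)^-1.

(** Without a crossing, the distance between two orbits would grow by [c = a ^ 2 / 2 > 1], up to an
    error [h], in one or two steps, against the bound 2. One step suffices when the two points have
    the same sign. Otherwise some [X r k] is 0, so [X r (k + 1) = 1] lies above the fixed point and
    no crossing makes every [X u (k + 1)] positive. Comparing [r] with the parameter whose point is
    farther from 0 loses a factor 2, but two expanding steps follow. *)
Lemma crit_orbit_crosses_fix a b : 0 < a -> 2 < a ^+ 2 -> a < b -> b <= 2 ->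
  exists m s t, [/\ a <= s <= b, a <= t <= b, X s m < tent_fix s &
                    tent_fix t < X t m].
Proof.
move=> a0 a2 ab b2; have a1 : 1 < a by nra.
pose c := a ^+ 2 / 2; have c1 : 1 < c by rewrite /c; lra.
have ca : c <= a by rewrite /c; nra.
have [k0 [al [be [C [h1 h2 h3 ex CB]]]]] := expands_large (2 / (c - 1)) a0 a2 ab b2.
pose h := be - al; have h0 : 0 < h by rewrite /h; lra.
have fix01 s : al <= s <= be -> 0 < tent_fix s < 1.
  by move=> s1; rewrite /tent_fix invr_gt0 invf_lt1; lra.
apply: contrapT => no_cross.
have sgn m : (forall s, al <= s <= be -> tent_fix s <= X s m) \/
    (forall s, al <= s <= be -> X s m <= tent_fix s).
  have [|] := pselect (forall s, al <= s <= be -> tent_fix s <= X s m); first by left.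
  move=> /existsNP[s /not_implyP[s1 /negP]]; rewrite -ltNge => ls.
  right=> t t1; rewrite leNgt; apply/negP => lt.
  by apply: no_cross; exists m, s, t; split=> //; lra.
have grow k s t E : al <= s <= be -> al <= t <= be -> 0 <= E -> E <= `|X s k - X t k| ->
    exists k' s' t', [/\ al <= s' <= be, al <= t' <= be & c * E - h <= `|X s' k' - X t' k'|].
  move=> s1 t1 E0 Est.
  have abs_h u v : al <= u <= be -> al <= v <= be -> `|u - v| <= h.
    by move=> u1 v1; rewrite ler_norml /h; lra.
  have spread u v j : al <= u <= be -> al <= v <= be -> 0 <= X u j * X v j ->
      a * `|X u j - X v j| - h <= `|X u j.+1 - X v j.+1|.
    move=> u1 v1 same; have := @crit_orbit_spread a u v j (ltW a1) _ _ same.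
    by have := abs_h _ _ u1 v1; move=> ? /(_ _ _)/(le_trans _); apply; lra.
  have [same|diff] := lerP 0 (X s k * X t k).
    exists k.+1, s, t; split=> //; apply: le_trans (spread _ _ _ s1 t1 same).
    have : c * E <= a * E by rewrite ler_wpM2r.
    have : a * E <= a * `|X s k - X t k| by rewrite ler_wpM2l // ltW.
    lra.
  have [r r1 Xr] : exists2 r, al <= r <= be & X r k = 0.
    have cX := @continuous_crit_orbit k.
    have [sk|sk] := ltrP (X s k) 0.
      have [|r r1 Xr] := @exists_zero_between _ s t cX; first by rewrite sk; nra.
      exists r => //; move: r1; rewrite ge_min le_max => /andP[/orP[] ? /orP[] ?]; lra.
    have Xt : X t k < 0 by rewrite ltNge; apply: contraTN diff => Xt; rewrite -leNgt mulr_ge0.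
    have Xs : 0 < X s k by rewrite lt_neqAle sk andbT; apply: contraTneq diff => <-; rewrite mul0r ltxx.
    have [|r r1 Xr] := @exists_zero_between _ t s cX; first by rewrite Xt.
    exists r => //; move: r1; rewrite ge_min le_max => /andP[/orP[] ? /orP[] ?]; lra.
  have Xr1 : X r k.+1 = 1 by rewrite crit_orbitS Xr normr0 mulr0 subr0.
  have pos u : al <= u <= be -> 0 < X u k.+1.
    move=> u1; have /andP[f0 _] := fix01 u u1; apply: lt_le_trans f0 _.
    case: (sgn k.+1) => [->//|/(_ r r1)]; rewrite Xr1.
    by have := fix01 r r1; lra.
  have half u : al <= u <= be -> E / 2 <= `|X u k| ->
      exists k' s' t', [/\ al <= s' <= be, al <= t' <= be & c * E - h <= `|X s' k' - X t' k'|].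
    move=> u1 Eu; exists k.+2, r, u; split=> //.
    have same : 0 <= X r k.+1 * X u k.+1 by rewrite mulr_ge0 // ltW // pos.
    apply: le_trans (spread _ _ _ r1 u1 same).
    rewrite Xr1 crit_orbitS (_ : 1 - (1 - _) = u * `|X u k|); last by ring.
    rewrite normrM normr_id (ger0_norm (_ : 0 <= u)); last by lra.
    rewrite lerB // /c; have : a * (E / 2) <= u * `|X u k| by apply: ler_pM; lra.
    nra.
  have tri : `|X s k - X t k| <= `|X s k| + `|X t k| by rewrite ler_normB.
  have [Es|Es] := lerP (E / 2) `|X s k|; first exact: half s1 Es.
  by apply: half t1 _; lra.
(* [th] is the fixed point of [E -> c E - h]; the initial expansion was chosen to give a distance of
   at least twice [th]. *)
pose th := h / (c - 1); have th0 : 0 < th by rewrite divr_gt0; lra.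
have the : th * (c - 1) = h by rewrite divfK // subr_eq0 gt_eqF.
have Ch : 2 * th <= C * h.
  have : 2 / (c - 1) * h <= C * h by rewrite ler_wpM2r // ltW.
  by rewrite /th; lra.
have iterate j : exists k s t, [/\ al <= s <= be, al <= t <= be &
    c ^+ j * th + th <= `|X s k - X t k|].
  elim: j => [|j [k [s [t [s1 t1 le]]]]].
    exists k0, be, al; split; try lra.
    apply: le_trans (ex al be (lexx _) h2 (lexx _)).
    by rewrite mul1r -/h; lra.
  have [|k' [s' [t' [s1' t1' le']]]] := grow k s t _ s1 t1 _ le.
    by apply: addr_ge0; [apply: mulr_ge0; [apply: exprn_ge0|]|]; lra.
  exists k', s', t'; split=> //; apply: le_trans le'.
  by rewrite exprS; move: (c ^+ j) => u; lra.
have [N HN] := exists_expr_ge (2 / th) c1.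
have [k [s [t [s1 t1]]]] := iterate N.
have := HN N (leqnn N); rewrite ler_pdivrMr // => cN.
have bs : `|X s k| <= 1 by apply: crit_orbit_bound; lra.
have bt : `|X t k| <= 1 by apply: crit_orbit_bound; lra.
have := ler_normB (X s k) (X t k); lra.
Qed.

End SlopeDependence.

(** * Itineraries of the critical orbit near a preperiodic slope *)

Section Words.
Variable R : realType.
Implicit Types (l x y p a b c d s t C E : R).
Local Notation X := (@crit_orbit R).

Lemma sharp_sign_change (G : R -> R) a b s t : continuous G ->
  (forall c d, a <= c <= b -> G c = 0 -> 0 < d -> exists2 x, c < x < c + d & G x != 0) ->
  a <= s <= b -> a <= t <= b -> G s < 0 < G t ->
  exists c, [/\ a <= c <= b, G c = 0 & forall d, 0 < d ->
    (exists2 x, `|c - x| < d & G x < 0) /\ (exists2 x, `|c - x| < d & 0 < G x)].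
Proof.
wlog st : G s t / s < t => [wl cG nf s1 t1 /andP[Gs Gt]|].
  have [st|ts|eq_st] := ltgtP s t; first by apply: (wl G s t) => //; rewrite Gs.
    have [|x d x1 Gx d0||c [c1 Gc Hc]] := wl (- G) t s ts _ _ t1 s1.
    - by move=> x; apply: cvgN; exact: cG.
    - have [|y y1 Gy] := nf x d x1 _ d0; first by move: Gx; rewrite fctE; lra.
      by exists y => //; rewrite fctE oppr_eq0.
    - by rewrite !fctE oppr_lt0 oppr_gt0 Gt.
    exists c; split=> // [|d /Hc[[x x1 Gx] [y y1 Gy]]].
      by move: Gc; rewrite fctE; lra.
    by split; [exists y | exists x] => //; rewrite !fctE in Gx Gy; lra.
  by move: Gs Gt; rewrite eq_st; lra.
move=> cG nf s1 t1 /andP[Gs Gt].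
have near x e : 0 < e -> exists2 d, 0 < d & forall y, `|x - y| < d -> `|G x - G y| < e.
  move=> e0; have := @cG x => /cvgr_dist_lt/(_ _ e0)/nbhs_ballP[d /= d0 Hd].
  by exists d.
(* At the last point [c] where [G] can be negative, negative values accumulate or are attained from
   the left; to the right [G] is nonnegative, and the isolation hypothesis makes it positive
   somewhere. *)
pose S := [set x | s <= x <= t /\ G x < 0].
have Ss : S s by split=> //; rewrite lexx ltW.
have supS : has_sup S by split; [exists s | exists t => x [/andP[]]].
pose c := sup S; have sc : s <= c by apply: sup_upper_bound.
have ct : c <= t by apply: ge_sup => [|x [/andP[]]]; first by exists s.
have left d : 0 < d -> exists2 x, `|c - x| < d & G x < 0.
  move=> d0; have [x [x1 Gx] xd] := sup_adherent d0 supS.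
  exists x => //; have xc : x <= c by apply: sup_upper_bound.
  by rewrite ger0_norm; rewrite -/c in xd; lra.
have right x : c < x -> x <= t -> 0 <= G x.
  move=> cx xt; rewrite leNgt; apply/negP => Gx.
  by have : x <= c by [apply: sup_upper_bound => //; split=> //; lra]; lra.
have Gc : G c = 0.
  have [Gc|Gc|//] := ltgtP (G c) 0.
    have [|d d0 Hd] := near c (- G c); first lra.
    have ct' : c < t by rewrite lt_neqAle ct andbT; apply: contraTneq Gt => <-; rewrite -leNgt ltW.
    pose x := Num.min t (c + d / 2).
    have xt : x <= t by rewrite ge_min lexx.
    have xd : x <= c + d / 2 by rewrite ge_min lexx orbT.
    have cx : c < x by rewrite lt_min; apply/andP; split; lra.
    have := Hd x; rewrite !ltr_distl => /(_ _); have := right x cx xt; lra.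
  have [d d0 Hd] := near c (G c) Gc.
  have [x xd Gx] := left d d0.
  by have := Hd x xd; rewrite ltr_distl; lra.
have c1 : a <= c <= b by lra.
have ct' : c < t by rewrite lt_neqAle ct andbT; apply: contraTneq Gt => <-; rewrite Gc ltxx.
exists c; split=> // d d0; split; first exact: left.
have [|x x1 Gx] := nf c (Num.min d (t - c)) c1 Gc.
  by rewrite lt_min d0 subr_gt0.
have m1 : Num.min d (t - c) <= d by rewrite ge_min lexx.
have m2 : Num.min d (t - c) <= t - c by rewrite ge_min lexx orbT.
exists x; first by rewrite ltr0_norm; lra.
rewrite lt_neqAle eq_sym Gx /=; apply: right; lra.
Qed.

Lemma kneading_poly_horner (e : nat -> bool) l m :
  (forall i, (0 < i < m)%N -> (X l i < 0) = e i) ->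
  X l m = (map_poly intr (kneading_poly e m)).[l].
Proof.
elim: m => [|m IHm] eE; first by rewrite map_poly0 horner0.
rewrite crit_orbitS /= rmorphB rmorph1 /= map_polyZ /= rmorphM /= map_polyX.
rewrite hornerD hornerN hornerC hornerZ hornerM hornerX -IHm; last first.
  by move=> i /andP[i0 im]; apply: eE; rewrite i0 ltnW.
congr (1 - _); rewrite rmorphXn rmorphN rmorph1 /= mulrCA; congr (_ * _).
have [->|m0] := posnP m; first by rewrite normr0 mulr0.
rewrite -eE ?m0 ?ltnSn //; have [Xm|Xm] := ltrP (X l m) 0; first by rewrite expr1 mulN1r (ltr0_norm Xm).
by rewrite expr0 mul1r (ger0_norm Xm).
Qed.

Lemma same_signs_near c m : (forall i, (0 < i < m)%N -> X c i != 0) ->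
  exists2 d, 0 < d & forall x, `|c - x| < d -> forall i, (0 < i < m)%N ->
    (X x i < 0) = (X c i < 0).
Proof.
elim: m => [|m IHm] nz; first by exists 1 => // x _ i; rewrite ltn0 andbF.
have [|d1 d10 H1] := IHm; first by move=> i /andP[i0 im]; apply: nz; rewrite i0 ltnW.
have [m0|m0] := posnP m.
  by exists 1 => // x _ i /andP[i0 im]; move: i0 im; rewrite m0 ltnS leqn0; case: i.
have Xm : 0 < `|X c m| by rewrite normr_gt0 nz // m0 ltnSn.
have := @continuous_crit_orbit R m c => /cvgr_dist_lt/(_ _ Xm)/nbhs_ballP[d2 /= d20 H2].
exists (Num.min d1 d2); first by rewrite lt_min d10.
move=> x; rewrite lt_min => /andP[x1 x2] i /andP[i0].
rewrite ltnS leq_eqVlt => /orP[/eqP ->|im]; last by apply: H1; rewrite ?i0.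
move: (H2 x x2) => /=; rewrite ltr_distl.
have [Xc|Xc] := ltrP (X c m) 0; have [Xx|Xx] := ltrP (X x m) 0 => //=.
  by rewrite (ltr0_norm Xc); lra.
by rewrite (ger0_norm Xc); lra.
Qed.

(** A return to 0 would recur at all multiples of [i], but from time [m] on the orbit sits at the
    positive fixed point. *)
Lemma crit_orbit_preperiodic_neq0 c m : 1 < c <= 2 -> X c m = tent_fix c ->
  forall i, (0 < i)%N -> X c i != 0.
Proof.
move=> /andP[c1 c2] Xm i i0; apply/negP => /eqP Xi.
have c10 : 1 + c != 0 by rewrite gt_eqF //; lra.
have fix0 : 0 < tent_fix c by rewrite invr_gt0; lra.
have Xfix j : X c (m + j) = tent_fix c.
  elim: j => [|j IHj]; first by rewrite addn0.
  by rewrite addnS crit_orbitS IHj (gtr0_norm fix0) /tent_fix; field.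
have Xper k : X c (k * i) = 0.
  elim: k => [//|k IHk]; rewrite mulSn /crit_orbit iterD -/(X c _) IHk.
  exact: Xi.
have le : (m <= m * i)%N by rewrite leq_pmulr.
have := Xfix (m * i - m)%N; rewrite subnKC // Xper.
by move=> h; move: fix0; rewrite -h ltxx.
Qed.

Lemma polynomial_nonroot (p : {poly R}) c d : p != 0 -> 0 < d ->
  exists2 x, c < x < c + d & ~~ root p x.
Proof.
move=> p0 d0; apply: contrapT => /forall2NP H.
pose g (i : nat) := c + d / i.+2%:R.
have gi : injective g.
  move=> i j /addrI/(mulfI (lt0r_neq0 d0))/invr_inj/eqP.
  by rewrite eqr_nat !eqSS => /eqP.
have rg i : root p (g i).
  have [h|/negP] := H (g i); last by rewrite negbK.
  case: h; rewrite /g ltrDl ltrD2l divr_gt0 // ltr_pdivrMr //=.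
  by rewrite ltr_pMr // ltr1n.
have := @max_poly_roots _ p (map g (iota 0 (size p))) p0.
rewrite map_inj_uniq // iota_uniq size_map size_iota ltnn => h; apply: notF; apply: h => //.
by apply/allP => _ /mapP[i _ ->].
Qed.

(** Near [c] the signs do not change, so the condition is a root of the single polynomial
    [(1 + X) K - 1], which is nonzero because its value at -1 is -1. *)
Lemma crit_orbit_fix_isolated m c d : 1 < c <= 2 -> 0 < d ->
  X c m - tent_fix c = 0 ->
  exists2 x, c < x < c + d & X x m - tent_fix x != 0.
Proof.
move=> c12 d0 /eqP; rewrite subr_eq0 => /eqP Xm.
have nz := crit_orbit_preperiodic_neq0 c12 Xm.
have [|d1 d10 H1] := @same_signs_near c m; first by move=> i /andP[/nz].
pose K : {poly R} := map_poly intr (kneading_poly (fun i => X c i < 0) m).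
have p0 : (1 + 'X) * K - 1 != 0.
  apply/negP => /eqP/(congr1 (horner^~ (-1))).
  rewrite /= !hornerE subrr mul0r sub0r.
  by move/eqP; rewrite oppr_eq0 oner_eq0.
have [|x x1 nr] := @polynomial_nonroot _ c (Num.min d d1) p0; first by rewrite lt_min d0.
have m1 : Num.min d d1 <= d by rewrite ge_min lexx.
have m2 : Num.min d d1 <= d1 by rewrite ge_min lexx orbT.
exists x; first lra.
rewrite (@kneading_poly_horner (fun i => X c i < 0)); last first.
  by apply: H1; rewrite ltr0_norm; lra.
apply: contraNneq nr; rewrite -/K => /eqP; rewrite subr_eq0 => /eqP Kx.
rewrite rootE hornerD hornerM hornerD hornerN !hornerC hornerX Kx.
by rewrite divff ?subrr // gt_eqF //; lra.
Qed.

(* In the coordinate [y = (1 + l) x - 1], centred at the fixed point, the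
   right branch of the tent map is [y |-> - l y]. *)
Lemma right_branch_run l m q (U : R) : 1 < l -> - U < l ^+ 2 -> U < 0 ->
  (- l) ^+ q * ((1 + l) * X l m - 1) = U ->
  (forall j, (j <= q)%N -> (1 + l) * X l (m + j) - 1 = (- l) ^+ j * ((1 + l) * X l m - 1)) /\
  (forall j, (j < q)%N -> 0 < X l (m + j)).
Proof.
move=> l1 Ul U0 yU.
have step j : (j < q)%N ->
    (1 + l) * X l (m + j) - 1 = (- l) ^+ j * ((1 + l) * X l m - 1) -> 0 < X l (m + j).
  move=> jq yE; pose i := (q - j)%N; have i0 : (0 < i)%N by rewrite subn_gt0.
  have iE : (- l) ^+ i * ((1 + l) * X l (m + j) - 1) = U.
    by rewrite yE mulrA -exprD subnK // ltnW.
  (* Being right of 0 means [y > -1]. If [y <= -1], the final value [U] would be positive for odd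
     [i] and at most [- l ^ 2] for even [i], both excluded. *)
  set y := _ - 1 in iE; have [y1|y1] := ltrP (- 1) y; first by rewrite /y in y1; nra.
  move: iE; rewrite exprNn -signr_odd; have := leq_ltn_trans i0 (ltnSn i).
  have li : l <= l ^+ i by rewrite -[leLHS]expr1 ler_weXn2l // ltW.
  have [odd_i|even_i] := boolP (odd i); first by rewrite expr1; nra.
  have li2 : l ^+ 2 <= l ^+ i by rewrite ler_weXn2l ?ltW //; case: (i) i0 even_i => [|[]].
  by rewrite expr0; nra.
have run j : (j <= q)%N -> (1 + l) * X l (m + j) - 1 = (- l) ^+ j * ((1 + l) * X l m - 1).
  elim: j => [|j IHj] jq; first by rewrite addn0 mul1r.
  have yj := IHj (ltnW jq); have Xj := step j jq yj.
  by rewrite addnS crit_orbitS (gtr0_norm Xj) exprS -mulrA -yj; ring.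
by split=> // j jq; apply: step => //; apply: run; exact: ltnW.
Qed.

End Words.

(** * Slopes whose critical orbit follows a prescribed word back to 0 *)

Section Construction.
Variable R : realType.
Implicit Types (l x y p a b c d s t C E : R).
Local Notation X := (@crit_orbit R).

(** In the coordinate [y] the left branch is [y |-> l (y + 2)] and the critical point is -1. The
    equation says that [q1] right steps, one left step and [q2] right steps end at -1; it puts [U]
    within [l ^ - (q2 + 1)] of -2. *)
Lemma word_hits_zero l m q1 q2 : 1 < l -> 1 < (l ^+ 2 - 2) * l ^+ q2.+1 ->
  l ^+ q2.+1 * ((- l) ^+ q1 * ((1 + l) * X l m - 1) + 2) = (-1) ^+ q2.+1 ->
  [/\ forall j, (j < q1)%N -> 0 < X l (m + j),
      X l (m + q1) < 0,
      forall j, (j < q2)%N -> 0 < X l ((m + q1).+1 + j) &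
      X l ((m + q1).+1 + q2) = 0].
Proof.
move=> l1 l2; set U := (- l) ^+ q1 * _ => UE.
have A1 : 1 < l ^+ q2.+1 by rewrite exprn_egt1.
have UB : `|l ^+ q2.+1 * (U + 2)| = 1 by rewrite UE normrX normrN1 expr1n.
have UB2 : -1 <= l ^+ q2.+1 * (U + 2) <= 1 by rewrite -ler_norml UB.
have [U1 U2] := andP UB2.
have Ult : U < -1 by move: (l ^+ q2.+1) A1 U2 => A *; nra.
have Ugt : - U < l ^+ 2 by move: (l ^+ q2.+1) A1 U1 l2 => A *; nra.
have [run1 pos1] := right_branch_run l1 Ugt (lt_trans Ult (ltrN10 _)) (erefl U).
have y1 := run1 q1 (leqnn _); rewrite -/U in y1.
have Xneg : X l (m + q1) < 0 by nra.
have y2 : (1 + l) * X l (m + q1).+1 - 1 = l * (U + 2).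
  by rewrite crit_orbitS (ltr0_norm Xneg) -y1; ring.
have U2E : (- l) ^+ q2 * ((1 + l) * X l (m + q1).+1 - 1) = -1.
  rewrite y2 exprNn -mulrA [l ^+ q2 * _]mulrA -exprSr UE -exprD addnS addnn.
  by rewrite -signr_odd /= odd_double expr1.
have l21 : - (-1) < l ^+ 2 by rewrite opprK exprn_egt1.
have [run2 pos2] := right_branch_run l1 l21 (ltrN10 _) U2E.
split=> //.
have := run2 q2 (leqnn _); rewrite U2E => yn.
have : (1 + l) * X l ((m + q1).+1 + q2) = 0 by lra.
by move/eqP; rewrite mulf_eq0 gt_eqF ?orFb; [move/eqP | lra].
Qed.

Lemma word_parameter a c x m q1 q2 : 1 < a -> 2 < a ^+ 2 -> a < c -> a < x ->
  (1 + c) * X c m = 1 -> (-1) ^+ q1 * ((1 + x) * X x m - 1) < 0 ->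
  3 <= a ^+ q1 * `|(1 + x) * X x m - 1| -> (a ^+ 2 - 2)^-1 + 1 <= a ^+ q2.+1 ->
  exists2 l, Num.min x c <= l <= Num.max x c &
    [/\ forall j, (j < q1)%N -> 0 < X l (m + j),
        X l (m + q1) < 0,
        forall j, (j < q2)%N -> 0 < X l ((m + q1).+1 + j) &
        X l ((m + q1).+1 + q2) = 0].
Proof.
move=> a1 a2 ac ax Yc Yx Yx3 q2_large; have a0 : 0 <= a by lra.
pose Y l := (1 + l) * X l m - 1; rewrite -!/(Y x) in Yx Yx3.
have contY : continuous Y.
  move=> y; apply: cvgB; last exact: cvg_cst.
  apply: cvgM; last exact: continuous_crit_orbit.
  by apply: cvgD; [exact: cvg_cst | exact: cvg_id].
(* Intermediate values: at [c] the inner factor is 2, at [x] it is at most [-3 + 2 = -1], and either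
   one outweighs the final sign. *)
pose H l := l ^+ q2.+1 * (((-1) ^+ q1 * l ^+ q1) * Y l + 2) - (-1) ^+ q2.+1.
have contH : continuous H.
  move=> y; apply: cvgB; last exact: cvg_cst.
  apply: cvgM; first exact: exprn_continuous.
  apply: cvgD; last exact: cvg_cst.
  apply: cvgM; last exact: contY.
  by apply: cvgM; [exact: cvg_cst | exact: exprn_continuous].
have sgnB : `|(-1) ^+ q2.+1| <= 1 :> R by rewrite normrX normrN1 expr1n.
move: sgnB; rewrite ler_norml => /andP[sgn1 sgn2].
have gt1 y : a < y -> 1 < y ^+ q2.+1 by move=> ay; rewrite exprn_egt1 //; lra.
have Hc0 : 0 < H c.
  by rewrite /H /Y Yc subrr mulr0 add0r; have := gt1 c ac; lra.
have Hx0 : H x < 0.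
  have ax1 : a ^+ q1 <= x ^+ q1 by rewrite lerXn2r ?nnegrE //; lra.
  have YxE : (-1) ^+ q1 * Y x = - `|Y x|.
    by rewrite -[LHS]opprK -(ltr0_norm Yx) normrM normrX normrN1 expr1n mul1r.
  have : ((-1) ^+ q1 * x ^+ q1) * Y x <= -3.
    rewrite mulrAC YxE mulNr lerN2; apply: le_trans Yx3 _.
    by rewrite mulrC ler_wpM2l.
  rewrite /H; move: (gt1 x ax) sgn1; move: (_ * Y x) (x ^+ q2.+1) (_ ^+ q2.+1).
  by clear => V A e; nra.
have [|l lcx Hl] := @exists_zero_between _ H x c contH; first by rewrite Hx0.
exists l => //.
have al : a < l.
  by case/andP: lcx; rewrite ge_min => /orP[] ? _; lra.
apply: word_hits_zero; first lra; last first.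
  by apply/eqP; rewrite (exprNn l) -subr_eq0; apply/eqP.
have al2 : a ^+ q2.+1 <= l ^+ q2.+1 by rewrite lerXn2r ?nnegrE //; lra.
have aal : a ^+ 2 < l ^+ 2 by rewrite ltrXn2r ?nnegrE //; lra.
have i0 : 0 < a ^+ 2 - 2 by lra.
have iE : (a ^+ 2 - 2) * (a ^+ 2 - 2)^-1 = 1 by rewrite divff // gt_eqF.
have le1 := le_trans q2_large al2.
apply: (@lt_le_trans _ _ ((a ^+ 2 - 2) * l ^+ q2.+1)).
  by apply: lt_le_trans (ler_wpM2l (ltW i0) le1); rewrite mulrDr iE; lra.
by rewrite ler_wpM2r ?exprn_ge0 //; lra.
Qed.

Lemma odd_sum_word (f : nat -> bool) m q1 q2 :
  (forall j, (j < q1)%N -> f (m + j) = false) -> f (m + q1) ->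
  (forall j, (j < q2)%N -> f ((m + q1).+1 + j) = false) ->
  odd (\sum_(i < (m + q1).+1 + q2) (odd i && f i)) =
  odd (\sum_(i < m) (odd i && f i)) (+) odd (m + q1).
Proof.
have run n q : (forall j, (j < q)%N -> f (n + j) = false) ->
    (\sum_(i < n + q) (odd i && f i) = \sum_(i < n) (odd i && f i))%N.
  elim: q => [|q IHq] fq; first by rewrite addn0.
  rewrite addnS big_ord_recr /= fq // andbF /= addn0 IHq // => j jq.
  by apply: fq; exact: ltnW.
move=> f1 fm f2; rewrite run // big_ord_recr /= fm andbT oddD oddb run //.
Qed.

(** [P] will be the minimal polynomial of [l], and [z] the conjugate near [z0]. Integer coefficients
    let both properties pass to [P (X ^ 2)]. *)
Definition good_parameter (z0 : R[i]) (eps l : R) : Prop :=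
  exists P : {poly int}, exists z : R[i], exists n : nat,
    [/\ eisenstein_at1 P, root (map_poly intr P) l, root (map_poly intr P) z,
        cabs (z - z0) < eps & (0 < n)%N /\ X l n = 0].

Lemma good_parameter_large a b (z0 : R[i]) (eps : R) :
  0 < a -> 2 < a ^+ 2 -> a < b -> b <= 2 -> cabs z0 = 1 -> 0 < eps ->
  exists2 l, a < l < b & good_parameter z0 eps l.
Proof.
move=> a0 a2 ab b2 nz0 eps0; have a1 : 1 < a by nra.
have [N0 near_root] := root_near_unit_circle nz0 eps0.
(* The margins leave room for a neighbourhood of [c] inside the interval. *)
pose a' := a + (b - a) / 3; pose b' := b - (b - a) / 3.
have aa' : a < a' by rewrite /a'; lra.
have [m [s [t [s1 t1 Xs Xt]]]] : exists m s t,
    [/\ a' <= s <= b', a' <= t <= b', X s m < tent_fix s & tent_fix t < X t m].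
  by apply: crit_orbit_crosses_fix; rewrite /a' /b' in aa' *; nra.
pose Y l := (1 + l) * X l m - 1.
have YE l : -1 < l -> Y l = (1 + l) * (X l m - tent_fix l).
  by move=> l1; rewrite /Y mulrBr /tent_fix divff // gt_eqF //; lra.
have contY : continuous Y.
  move=> x; apply: cvgB; last exact: cvg_cst.
  apply: cvgM; last exact: continuous_crit_orbit.
  by apply: cvgD; [exact: cvg_cst | exact: cvg_id].
have a'b' : 1 < a' /\ b' < 2 by rewrite /a' /b'; lra.
have [c [c1 Yc Hc]] : exists c, [/\ a' <= c <= b', Y c = 0 & forall d, 0 < d ->
    (exists2 x, `|c - x| < d & Y x < 0) /\ (exists2 x, `|c - x| < d & 0 < Y x)].
  apply: (sharp_sign_change contY _ s1 t1) => [c d c1 Yc d0|].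
    have [|||x x1 Gx] := @crit_orbit_fix_isolated _ m c d; [lra|by []| |].
      by move: Yc; rewrite YE; [move/eqP; rewrite mulf_eq0 gt_eqF ?orFb; [move/eqP | lra] | lra].
    have x0 : 0 < 1 + x by lra.
    by exists x; rewrite // YE ?mulf_neq0 ?(gt_eqF x0) //; lra.
  rewrite !YE; try lra; apply/andP; split.
    by rewrite pmulr_rlt0; lra.
  by rewrite pmulr_rgt0; lra.
have Xc : X c m = tent_fix c.
  by move: Yc; rewrite YE; [move/eqP; rewrite mulf_eq0 gt_eqF ?orFb; [move/eqP | ] | ]; lra.
have nz := @crit_orbit_preperiodic_neq0 _ c m _ Xc.
have [|d1 d10 sgn] := @same_signs_near _ c m; first by move=> i /andP[/nz nzi _]; apply: nzi; lra.
pose d := Num.min d1 ((b - a) / 3).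
have d0 : 0 < d by rewrite lt_min d10; lra.
have dd1 : d <= d1 by rewrite ge_min lexx.
have dab : d <= (b - a) / 3 by rewrite ge_min lexx orbT.
have within x : `|c - x| < d -> a < x < b.
  by rewrite ltr_distl; rewrite /a' /b' in c1; lra.
have [[p pd Yp] [q qd Yq]] := Hc d d0.
pose W := (\sum_(i < m) (odd i && (X c i < 0)%R))%N.
have [Np HNp] := exists_expr_ge (3 / `|Y p|) a1.
have [Nq HNq] := exists_expr_ge (3 / `|Y q|) a1.
have [q1 [oddW Np1 Nq1]] : exists q1, [/\ odd W (+) odd (m + q1), (Np <= q1)%N & (Nq <= q1)%N].
  have [h|h] := boolP (odd W (+) odd (m + (Np + Nq))).
    by exists (Np + Nq)%N; rewrite h leq_addr leq_addl.
  exists (Np + Nq).+1; rewrite addnS /= addbN h; split=> //; apply: leqW.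
    exact: leq_addr.
  exact: leq_addl.
(* The parity of [q1] is already imposed by the condition modulo 4, so the sign of [Y x] must adapt;
   this is why [Y] needs both signs arbitrarily close to [c]. *)
have [x [xd Yx Yx3]] : exists x, [/\ `|c - x| < d, (-1) ^+ q1 * Y x < 0 & 3 <= a ^+ q1 * `|Y x|].
  rewrite -signr_odd; case: (odd q1).
    exists q; split=> //; first by rewrite expr1; lra.
    by rewrite -ler_pdivrMr ?normr_gt0 ?gt_eqF // HNq.
  exists p; split=> //; first by rewrite expr0; lra.
  by rewrite -ler_pdivrMr ?normr_gt0 ?lt_eqF // HNp.
have [N2 HN2] := exists_expr_ge ((a ^+ 2 - 2)^-1 + 1) a1.
(* The last run fills the word up to length [2 ^ k]; as [k < 2 ^ k], that run has at least [N2]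
   signs and the degree is large enough for [near_root]. *)
pose k := ((m + q1).+1 + (N2 + N0))%N; pose n := (2 ^ k)%N.
have kn : (k < n)%N by rewrite ltn_expl.
pose q2 := (n - (m + q1).+1)%N.
have nE : ((m + q1).+1 + q2)%N = n.
  by rewrite subnKC //; apply: leq_trans (ltnW kn); exact: leq_addr.
have N2q : (N2 <= q2.+1)%N.
  apply: leqW; rewrite -(leq_add2l (m + q1).+1) nE; apply: leq_trans (ltnW kn).
  by rewrite leq_add2l leq_addr.
have /andP[ax xb] := within x xd.
have /andP[ac cb] : a < c < b by apply: within; rewrite subrr normr0.
have [||l lcx [pos1 neg pos2 Xn]] := @word_parameter a c x m q1 q2 a1 a2 ac ax _ Yx Yx3.
- by apply/eqP; rewrite -subr_eq0; apply/eqP.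
- exact: HN2.
have ld : `|c - l| < d.
  move: lcx xd; rewrite ge_min le_max !ltr_distl; move: d0; clear.
  by move=> d0 /andP[/orP[] ? /orP[] ?]; lra.
have /andP[al lb] := within l ld.
rewrite nE in Xn.
pose e i := X l i < 0.
have oddS : odd (\sum_(i < n) (odd i && e i)).
  rewrite -nE odd_sum_word //; last 2 first.
  - by move=> j /pos1 h; apply/negbTE; rewrite /e -leNgt ltW.
  - by move=> j /pos2 h; apply/negbTE; rewrite /e -leNgt ltW.
  rewrite (_ : (\sum_(i < m) _)%N = W) //; apply: eq_bigr => i _.
  have [i0|i0] := posnP i; first by rewrite i0.
  by rewrite /e sgn ?i0 //= (lt_le_trans ld).
have k0 : (0 < k)%N by [].
have [P eP [u u0 PE]] := kneading_poly_eisenstein k0 oddS.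
have Kl : (map_poly intr (kneading_poly e n)).[l] = 0 by rewrite -kneading_poly_horner.
pose K : {poly R[i]} := map_poly intr (kneading_poly e n).
have szK : size K = n.
  by rewrite size_map_inj_poly ?size_kneading_poly //; exact: intr_inj.
have [||z /rootP Kz zz0] := near_root K.
- by rewrite szK; apply: leq_ltn_trans kn; rewrite /k addnA leq_addl.
- move=> i; rewrite szK => iN; apply: complexI; rewrite -cabsE coef_map.
  by rewrite /= -intr_norm kneading_poly_coef iN.
exists l; first by rewrite al.
exists P, z, n; split=> //.
- by rewrite PE map_polyZ rootE hornerZ Kl mulr0.
- by rewrite PE map_polyZ rootE hornerZ Kz mulr0.
- by rewrite expn_gt0.
Qed.

End Construction.

(** * Renormalisation, and good slopes in every interval *)

Section Renormalization.
Variable R : realType.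
Implicit Types (l a b eps : R) (z : R[i]).

(** For [l ^ 2 <= 2] the factor [l (l - 1)] is at most 1, so the intermediate point
    [1 - l (l - 1) |x|] is nonnegative and two steps give [1 - l (1 - l (l - 1) |x|) = (1 - l) (1 -
    l ^ 2 |x|)]. *)
Lemma crit_orbit_renormalization l n : 1 <= l -> l ^+ 2 <= 2 ->
  crit_orbit l n.*2 = (1 - l) * crit_orbit (l ^+ 2) n.
Proof.
move=> l1 l2; elim: n => [|n IHn]; first by rewrite mulr0.
rewrite doubleS !crit_orbitS IHn.
have x1 : `|crit_orbit (l ^+ 2) n| <= 1 by apply: crit_orbit_bound; nra.
have x0 := normr_ge0 (crit_orbit (l ^+ 2) n).
rewrite normrM (ler0_norm (_ : 1 - l <= 0)); last lra.
move: (`|crit_orbit _ _|) x0 x1 => x x0 x1.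
rewrite ger0_norm; first by ring.
have : l * (l - 1) <= 1 by nra.
have : 0 <= l * (l - 1) by apply: mulr_ge0; lra.
rewrite (_ : l * (_ * x) = l * (l - 1) * x); last by ring.
by move: (l * (l - 1)) => u u0 u1; nra.
Qed.

(** The distances from [z0] to the two square roots of [z] have product [|z - z0 ^ 2| < eps ^ 2], so
    one of them is below [eps]. *)
Lemma good_parameter_sqrt (z0 : R[i]) eps l : 1 <= l -> l ^+ 2 <= 2 -> 0 < eps ->
  good_parameter (z0 ^+ 2) (eps ^+ 2) (l ^+ 2) -> good_parameter z0 eps l.
Proof.
move=> l1 l2 eps0 [P [z [n [eP Pl Pz zz0 [n0 Xn]]]]].
have root_comp (S : idomainType) (x y : S) : y ^+ 2 = x -> root (map_poly intr P) x ->
    root (map_poly intr (P \Po 'X^2)) y.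
  by move=> <-; rewrite map_comp_poly map_polyXn !rootE horner_comp hornerXn.
suff [s sz sz0] : exists2 s, s ^+ 2 = z & cabs (s - z0) < eps.
  exists (P \Po 'X^2), s, n.*2; split=> //.
  - exact: eisenstein_at1_sqr.
  - exact: root_comp Pl.
  - exact: root_comp Pz.
  - by rewrite double_gt0 n0 crit_orbit_renormalization // Xn mulr0.
pose s := sqrtc z; have sE : s ^+ 2 = z by exact: sqr_sqrtc.
have [lt|le] := ltrP (cabs (s - z0)) eps; first by exists s.
exists (- s); first by rewrite sqrrN.
rewrite -opprD cabsN; move: zz0; rewrite -sE subr_sqr cabsM => zz0.
rewrite ltNge; apply/negP => le'; move: zz0; rewrite ltNge expr2 => /negP; apply.
by apply: ler_pM => //; exact: ltW.
Qed.

Lemma good_parameter_dense a b (z0 : R[i]) eps : 1 < a -> a < b -> b <= 2 ->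
  cabs z0 = 1 -> 0 < eps -> exists2 l, a < l < b & good_parameter z0 eps l.
Proof.
move=> a1 ab b2 nz0 eps0; have [N HN] := exists_expr_ge 2 a1.
have := HN _ (ltnW (ltn_expl N (ltnSn 1))) => {HN}.
(* Induction on the number of squarings that bring [a] to 2 or beyond. If [b ^ 2 <= 2] the interval
   is squared; otherwise its part above [sqrt 2] is treated directly. *)
elim: N => [|N IHN] in a b z0 eps a1 ab b2 nz0 eps0 *; first by rewrite expn0 expr1; lra.
rewrite expnS exprM => aN; have [b22|b22] := lerP (b ^+ 2) 2.
  have [||||||l /andP[al lb] gl] := IHN (a ^+ 2) (b ^+ 2) (z0 ^+ 2) (eps ^+ 2) => //.
  - by rewrite exprn_egt1.
  - by rewrite ltrXn2r ?nnegrE //; lra.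
  - by rewrite cabsX nz0 expr1n.
  - by rewrite exprn_gt0.
  have l0 : 0 <= l by apply: le_trans (ltW al); rewrite sqr_ge0.
  have sl : Num.sqrt l ^+ 2 = l by rewrite sqr_sqrtr.
  have s0 : 0 <= Num.sqrt l := sqrtr_ge0 l.
  have as_ : a < Num.sqrt l by rewrite -sl in al; rewrite -(@ltr_pXn2r _ 2) ?nnegrE //; lra.
  exists (Num.sqrt l).
    by rewrite as_ /= -(@ltr_pXn2r _ 2) ?nnegrE ?sl //; lra.
  by apply: good_parameter_sqrt; rewrite ?sl //; lra.
pose s := Num.sqrt (2 : R); have s2 : s ^+ 2 = 2 by rewrite sqr_sqrtr.
have s0 : 0 < s by rewrite sqrtr_gt0.
have sb : s < b by rewrite -(@ltr_pXn2r _ 2) ?nnegrE ?s2 //; lra.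
pose a' := Num.max a ((s + b) / 2).
have aa' : a <= a' by rewrite le_max lexx.
have sa' : (s + b) / 2 <= a' by rewrite le_max lexx orbT.
have a'b : a' < b by rewrite gt_max ab; lra.
have [||||||l /andP[al lb] gl] := @good_parameter_large R a' b z0 eps => //; first lra.
  by rewrite -s2 ltrXn2r ?nnegrE //; lra.
by exists l => //; lra.
Qed.

End Renormalization.

Theorem theorem2 (R : realType) :
  @unit_circle R `*` `[(1 : R), 2] `<=` @master_teapot R.
Proof.
move=> [z0 l0] [/= nz0]; rewrite in_itv /= => /andP[l1 l2] B [[U V]] /= [].
have {}nz0 : cabs z0 = 1 by apply: complexI; rewrite -cabsE nz0.
move=> /nbhs_ballP[e /= e0 HU] /nbhs_ballP[d /= d0 HV] UV.
(* Balls of [R[i]] have radii in [R[i]]; a positive one is real. *)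
have eE : e = (complex.Re e)%:C%C by case: e e0 {HU} => x y; rewrite ltcE /= => /andP[/eqP -> _].
have e0' : 0 < complex.Re e by rewrite -ltcR -eE.
(* Capping at 1 keeps an interval on one side of [l0] inside [(1, 2]]: to the right for
   [l0 <= 3 / 2], to the left otherwise. *)
pose d' := Num.min d 1; have d'0 : 0 < d' by rewrite lt_min d0 ltr01.
have d'd : d' <= d by rewrite ge_min lexx.
have d'1 : d' <= 1 by rewrite ge_min lexx orbT.
have [a [b [a1 ab b2 near]]] : exists a b, [/\ 1 < a, a < b, b <= 2 &
    forall l, a < l < b -> `|l0 - l| < d].
  have [le|lt] := lerP l0 (3 / 2).
    exists (l0 + d' / 4), (l0 + d' / 2); split; try lra.
    by move=> l; rewrite ltr_distl; lra.
  exists (l0 - d' / 2), (l0 - d' / 4); split; try lra.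
  by move=> l; rewrite ltr_distl; lra.
have [l lab [P [z [n [eP Pl Pz zz0 [n0 Xn]]]]]] := @good_parameter_dense R a b z0 _ a1 ab b2 nz0 e0'.
have l12 : 1 < l <= 2 by lra.
exists (z, l); split.
  exists (tent l), (-1), 1; split.
  - exists 0; first exact: unimodal_tent.
    by exists n.
  - exact: growth_rate_tent.
  exists (map_poly intr P); first exact: eisenstein_at1_minimal.
  by rewrite -map_poly_comp; under eq_map_poly => x do rewrite /= ratr_int.
apply: UV; split => /=.
  by apply: HU; rewrite /ball /= cabsE eE ltcR cabsB.
by apply: HV; rewrite /ball /=; exact: near.
Qed.
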